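(* The following transformations or motions describe the same semi-discrete system: (i) (smooth) arc-length polarization preserving (iterated) Darboux transformations of a polarized curve; (ii) (discrete) arc-length polarization preserving infinitesimal Darboux transformation of a discrete polarized curve; (iii) the isoperimetric motion (as described in the context) of a discrete curve resulting in the semi-discrete potential mKdV equation $\left(\frac{\theta_{n+1}+\theta_n}{2}\right)'=\frac{2}{a_n}\sin\left(\frac{\theta_{n+1}-\theta_n}{2}\right)$.
   Context: Identify $\mathbb{R}^2\cong\mathbb{C}$; products of complex numbers are complex products. $I\subset\mathbb{R}$ is an interval with parameter $s$, $'$ denotes $\frac{d}{ds}$, and $\Sigma\subset\mathbb{Z}$ is a discrete interval (a set of consecutive integers) with edges $(n,n+1)$. Each of the three descriptions concerns a map $x:\Sigma\times I\to\mathbb{C}$, $(n,s)\mapsto x_n(s)$, smooth in $s$. ''The same semi-discrete system'' is understood up to a reparametrization of $s$ common to all $n$ (in (i) and (ii) one reparametrizes so that $m\equiv1$). For (i): a polarized curve $x:(I,\frac{ds^2}{m})\to\mathbb{C}$ is a smooth curve together with the quadratic differential $\frac{ds^2}{m}$, where $m:I\to\mathbb{R}^\times$. For a constant $\mu\in\mathbb{R}^\times$, two polarized curves $x,\hat x:(I,\frac{ds^2}{m})\to\mathbb{C}$ are a Darboux pair with parameter $\mu$ (each is a Darboux transform of the other) if $\frac{x'\hat x'}{(x-\hat x)^2}ds^2=\frac{\mu}{m}ds^2$. The differential $\frac{ds^2}{m}$ is the arc-length polarization of $x$ if $\frac{ds^2}{m}=|dx|^2$. In iterated Darboux transformations, consecutive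 curves $x_n,x_{n+1}$ form a Darboux pair with a parameter $\mu_{(n,n+1)}$ with respect to the same polarization $\frac{ds^2}{m}$; they preserve the arc-length polarization if $\frac{ds^2}{m}$ is the arc-length polarization of every $x_n$. For (ii): a discrete polarized curve $x^0:(\Sigma,\frac1\mu)\to\mathbb{C}$ is a discrete curve $x^0:\Sigma\to\mathbb{C}$ together with a strictly positive or strictly negative function $\mu$ on the unoriented edges of $\Sigma$. The function $\mu$ is the discrete arc-length polarization of a discrete curve $x$ if $\frac1{\mu_{(n,n+1)}}=|x_n-x_{n+1}|^2$ on every edge. For $m:I\to\mathbb{R}^\times$, an infinitesimal Darboux transformation of $x^0$ with parameter function $m$ is a smooth motion $x:\Sigma\times I\to\mathbb{C}$ of $x^0$, i.e. $x_n(s_0)=x^0_n$ for some $s_0\in I$, so that on every edge $\frac{x_n'x_{n+1}'}{(x_n-x_{n+1})^2}ds^2=\frac{\mu_{(n,n+1)}}{m}ds^2$. It preserves the discrete arc-length polarization if $\mu$ is the discrete arc-length polarization of $x^0$ and of $n\mapsto x_n(s)$ for every $s\in I$. For (iii): one starts with a discrete curve that is regular, i.e. $\det(x_n-x_{n-1}\;\;x_{n+1}-x_n)\ne0$ on any three consecutive vertices, and considers a continuous motion $x:\Sigma\times I\to\mathbb{C}$ of it with $|x_n'|$ constant for all $(n,s)$, normalized by a constant scaling of $s$ to $|x_n'|\equiv1$. Put $a_n=|x_{n+1}-x_n|$, $T_n=(x_{n+1}-x_n)/a_n$, let $N_n$ be $T_n$ rotated counterclockwise by $\frac{\pi}{2}$,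 let $w_n$ be defined by $x_n'=\cos w_n\,T_n+\sin w_n\,N_n$, and let the discrete curvature $\kappa_{n+1}$ be the angle from $T_n$ to $T_{n+1}$. The motion is required to be isoperimetric ($a_n'\equiv0$), which, excluding trivial deformations, means $w_{n+1}+\kappa_{n+1}=-w_n$. The function $\theta_n$ is the tangential angle of the smooth curve $x_n(s)$, i.e. $x_n'=e^{i\theta_n}$.
   Formalization: Trivial deformations (an edge translated transversally to itself for all s) are excluded also in (i); the initial regularity of (iii) is imposed on (i) to conclude (iii), and on (ii) to conclude (i) or (iii), where Σ must also have three consecutive vertices. *)

(* Defs.v *)
From Stdlib Require Import Reals ZArith.
From Coquelicot Require Import Coquelicot.

Open Scope R_scope.

Definition interval (I : R -> Prop) : Prop :=
  (forall a b c : R, I a -> I c -> a <= b <= c -> I b) /\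
  (exists a b : R, I a /\ I b /\ a < b).

(* Coquelicot's [is_derive f s l] with the filter restricted to [I]: the
   interval may contain its endpoints, where this is the one-sided derivative. *)
Definition is_derive_on {V : NormedModule R_AbsRing}
    (I : R -> Prop) (f : R -> V) (s : R) (l : V) : Prop :=
  filterdiff f (within I (locally s)) (fun h : R => scal h l).

Fixpoint of_class {V : NormedModule R_AbsRing}
    (k : nat) (I : R -> Prop) (f : R -> V) : Prop :=
  match k with
  | O => continuous_on I f
  | S k' => exists g : R -> V,
      (forall s : R, I s -> is_derive_on I f s (g s)) /\ of_class k' I g
  end.

Definition smooth_on {V : NormedModule R_AbsRing}
    (I : R -> Prop) (f : R -> V) : Prop := forall k : nat, of_class k I f.

(* Total derivative operator, in the style of [RInt]; it is meaningful where
   [f] is differentiable along the nondegenerate interval [I]. *)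
Definition D {V : CompleteNormedModule R_AbsRing}
    (I : R -> Prop) (f : R -> V) (s : R) : V :=
  iota (is_derive_on I f s).

(* C carries its structure of normed space over R. *)
Notation smooth_curve I c := (@smooth_on C_R_NormedModule I c).
Notation vel I c := (@D C_R_CompleteNormedModule I c).

(* The old parameter [s] ranges over [I], the new one [t] over [J].  On an
   interval, [sigma' <> 0] makes [sigma] injective with smooth inverse. *)
Definition reparametrization (J I : R -> Prop) (sigma : R -> R) : Prop :=
  interval J /\
  @smooth_on R_NormedModule J sigma /\
  (forall t : R, J t -> I (sigma t)) /\
  (forall s : R, I s -> exists t : R, J t /\ sigma t = s) /\
  (forall t : R, J t -> @D R_CompleteNormedModule J sigma t <> 0).

Definition expi (phi : R) : C := (cos phi, sin phi).

Definition det2 (a b : C) : R := Re a * Im b - Im a * Re b.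

Definition discrete_interval (Sigma : Z -> Prop) : Prop :=
  forall a b c : Z, Sigma a -> Sigma c -> (a <= b <= c)%Z -> Sigma b.

(* Edge functions are indexed by n, for the edge (n, n+1). *)
Definition edge (Sigma : Z -> Prop) (n : Z) : Prop :=
  Sigma n /\ Sigma (n + 1)%Z.

Definition three_vertices (Sigma : Z -> Prop) : Prop :=
  exists n : Z, Sigma (n - 1)%Z /\ Sigma n /\ Sigma (n + 1)%Z.

Definition regular (Sigma : Z -> Prop) (c : Z -> C) : Prop :=
  forall n : Z, Sigma (n - 1)%Z -> Sigma n -> Sigma (n + 1)%Z ->
    det2 (c n - c (n - 1)%Z)%C (c (n + 1)%Z - c n)%C <> 0.

Definition starts_regular (Sigma : Z -> Prop) (I : R -> Prop)
    (x : Z -> R -> C) : Prop :=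
  exists s0 : R, I s0 /\ regular Sigma (fun n => x n s0).

(* An edge is trivially deformed if it is only translated, transversally to
   its own direction.  In terms of the angles below: w_(n+1) + k_(n+1) = w_n
   holds while w_(n+1) + k_(n+1) = - w_n fails.  (A translation of the edge
   along itself satisfies both equations.) *)
Definition nontrivial (Sigma : Z -> Prop) (I : R -> Prop)
    (x : Z -> R -> C) : Prop :=
  forall n : Z, edge Sigma n ->
    ~ (forall s : R, I s ->
         vel I (x (n + 1)%Z) s = vel I (x n) s /\
         det2 (vel I (x n) s) (x (n + 1)%Z s - x n s)%C <> 0).

(* The polarization is ds^2 / m. *)
Definition darboux_pair (I : R -> Prop) (m : R -> R) (mu : R)
    (x xh : R -> C) : Prop :=
  forall s : R, I s ->
    x s <> xh s /\
    (vel I x s * vel I xh s / (x s - xh s) ^ 2)%C = RtoC (mu / m s).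

Definition arc_length_polarization (I : R -> Prop) (m : R -> R)
    (x : R -> C) : Prop :=
  forall s : R, I s -> 1 / m s = (Cmod (vel I x s)) ^ 2.

Definition arc_length_darboux (Sigma : Z -> Prop) (I : R -> Prop)
    (x : Z -> R -> C) : Prop :=
  exists (m : R -> R) (mu : Z -> R),
    (forall s : R, I s -> m s <> 0) /\
    (forall n : Z, edge Sigma n ->
       mu n <> 0 /\ darboux_pair I m (mu n) (x n) (x (n + 1)%Z)) /\
    (forall n : Z, Sigma n -> arc_length_polarization I m (x n)).

(* The polarization is 1 / mu. *)
Definition discrete_polarization (Sigma : Z -> Prop) (mu : Z -> R) : Prop :=
  (forall n : Z, edge Sigma n -> 0 < mu n) \/
  (forall n : Z, edge Sigma n -> mu n < 0).

Definition discrete_arc_length_polarization (Sigma : Z -> Prop)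
    (mu : Z -> R) (c : Z -> C) : Prop :=
  forall n : Z, edge Sigma n -> 1 / mu n = (Cmod (c n - c (n + 1)%Z)%C) ^ 2.

Definition infinitesimal_darboux (Sigma : Z -> Prop) (I : R -> Prop)
    (x0 : Z -> C) (mu : Z -> R) (m : R -> R) (x : Z -> R -> C) : Prop :=
  (exists s0 : R, I s0 /\ forall n : Z, Sigma n -> x n s0 = x0 n) /\
  (forall n : Z, edge Sigma n -> darboux_pair I m (mu n) (x n) (x (n + 1)%Z)).

Definition arc_length_infinitesimal_darboux (Sigma : Z -> Prop)
    (I : R -> Prop) (x : Z -> R -> C) : Prop :=
  exists (x0 : Z -> C) (mu : Z -> R) (m : R -> R),
    discrete_polarization Sigma mu /\
    (forall s : R, I s -> m s <> 0) /\
    infinitesimal_darboux Sigma I x0 mu m x /\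
    discrete_arc_length_polarization Sigma mu x0 /\
    (forall s : R, I s ->
       discrete_arc_length_polarization Sigma mu (fun n => x n s)).

Definition edge_length (x : Z -> R -> C) (n : Z) (s : R) : R :=
  Cmod (x (n + 1)%Z s - x n s)%C.

Definition tangent (x : Z -> R -> C) (n : Z) (s : R) : C :=
  ((x (n + 1)%Z s - x n s) / RtoC (edge_length x n s))%C.

Definition normal (x : Z -> R -> C) (n : Z) (s : R) : C :=
  (Ci * tangent x n s)%C.

(* The vector at angle [w] from the tangent of the edge (n, n+1). *)
Definition direction (x : Z -> R -> C) (n : Z) (s w : R) : C :=
  (RtoC (cos w) * tangent x n s + RtoC (sin w) * normal x n s)%C.

(* [w] and [k] are any real representatives of the angles, so that the last
   condition is an equation modulo 2 pi.  At an interior vertex n+1 the angle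
   from T_n to x_(n+1)' is w_(n+1) + k_(n+1).  If n+1 is the last vertex of
   Sigma, then T_(n+1), w_(n+1) and k_(n+1) do not exist and the condition on
   the edge (n, n+1) is stated for that angle itself. *)
Definition isoperimetric_motion (Sigma : Z -> Prop) (I : R -> Prop)
    (x : Z -> R -> C) : Prop :=
  starts_regular Sigma I x /\
  (forall (n : Z) (s : R), Sigma n -> I s -> Cmod (vel I (x n) s) = 1) /\
  (forall (n : Z) (s : R), edge Sigma n -> I s ->
     x n s <> x (n + 1)%Z s /\
     @is_derive_on R_NormedModule I (edge_length x n) s 0) /\
  (exists w k : Z -> R -> R, forall (n : Z) (s : R), edge Sigma n -> I s ->
     vel I (x n) s = direction x n s (w n s) /\
     (Sigma (n + 2)%Z ->
        tangent x (n + 1)%Z s = (expi (k (n + 1)%Z s) * tangent x n s)%C /\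
        w (n + 1)%Z s + k (n + 1)%Z s = - w n s) /\
     (~ Sigma (n + 2)%Z ->
        vel I (x (n + 1)%Z) s = direction x n s (- w n s))).

Definition tangential_angles (Sigma : Z -> Prop) (I : R -> Prop)
    (x : Z -> R -> C) (theta : Z -> R -> R) : Prop :=
  forall n : Z, Sigma n ->
    @smooth_on R_NormedModule I (theta n) /\
    (forall s : R, I s -> vel I (x n) s = expi (theta n s)).

Definition semidiscrete_mKdV (Sigma : Z -> Prop) (I : R -> Prop)
    (x : Z -> R -> C) (theta : Z -> R -> R) : Prop :=
  forall (n : Z) (s : R), edge Sigma n -> I s ->
    @is_derive_on R_NormedModule I
      (fun r => (theta (n + 1)%Z r + theta n r) / 2) s
      (2 / edge_length x n s * sin ((theta (n + 1)%Z s - theta n s) / 2)).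

(* Each theta_n is determined up to a multiple of 2 pi, but the right-hand
   side of the equation changes sign when theta_n is replaced by
   theta_n + 2 pi, so the multiples have to be chosen consistently. *)
Definition results_in_mKdV (Sigma : Z -> Prop) (I : R -> Prop)
    (x : Z -> R -> C) : Prop :=
  (exists theta : Z -> R -> R, tangential_angles Sigma I x theta) /\
  (forall theta : Z -> R -> R, tangential_angles Sigma I x theta ->
     exists j : Z -> Z,
       semidiscrete_mKdV Sigma I x
         (fun n s => theta n s + 2 * PI * IZR (j n))).

(* Main.v *)
Require Import Defs.
From Stdlib Require Import Reals ZArith Lra Lia ClassicalEpsilon.
From Coquelicot Require Import Coquelicot.

(** Write [d = x_(n+1) - x_n] for an edge, [u], [v] for the velocities of its two
    end points, and [T = d / |d|].  Everything rests on one relation.  If the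
    velocities have the common length given by the polarization, taking moduli in
    the Darboux relation [u v / d^2 = mu / m] shows that [|d|^2 = 1 / |mu|] is
    constant, so the discrete polarization is the discrete arc-length one.  In unit
    speed the relation then reads [u v = T^2] or [u v = - T^2] according to the sign
    of [mu].  The first says that [v] is the reflection of [u] in the direction of
    the edge, which is exactly [w_(n+1) + k_(n+1) = - w_n].  In the second, constant
    edge length forces [u = v] orthogonal to [T]: the edge is translated, which is
    the trivial deformation ([trivial_of_negative]).  This gives the equivalence of
    (i) and (iii) once a curve can be parametrized by arc length, endpoints of the
    interval included ([arc_length_reparametrization]), and it gives (ii) from (i).

    From (ii) to (i) the common length of the velocities has to be recovered.  In
    the frame of an edge, constant edge length and the Darboux relation leave two
    possibilities ([edge_dichotomy]): equal speeds, or both velocities orthogonal to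
    the edge.  Suppose that at some time the speeds along an edge differ.  They
    differ on a neighbourhood, hence there the middle velocity of three consecutive
    vertices [p], [q], [r] is orthogonal to both edges and the three points stay
    collinear.  Differentiating the collinearity shows that the two edges are folded
    onto each other, [r = p], and that their parameters agree ([fold_of_collinear]).
    But with equal parameters [r - p] satisfies a linear homogeneous differential
    equation on all of [I], so [r = p] throughout ([fold_persists]), against the
    regularity at the initial time.  The sign of [m] is settled in the same spirit:
    it cannot be negative where the curve is regular, and it cannot change
    ([arc_length_of_triple]).

    For the mKdV equation, [u v = T^2] says that the mean [phi] of the two
    tangential angles is the direction of the edge up to sign.  The sign is constant
    in time, and is removed by shifting the angles by multiples of [2 PI]; then
    differentiating [d = a e^(i phi)] with [a] constant is the equation
    ([mKdV_of_half_angle]).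

    Velocities are one-sided at the endpoints of [I].  Real functions are handled
    through the slope characterization [der_slope] of such derivatives, and curves
    through their two coordinates. *)

(** * Continuity and derivatives along an interval *)

Definition continuous_within (I : R -> Prop) (f : R -> R) (s : R) : Prop :=
  filterlim f (within I (locally s)) (locally (f s)).

Notation der I f s l := (@is_derive_on R_NormedModule I f s l).

Lemma continuous_within_eps (I : R -> Prop) (f : R -> R) (s : R) :
  continuous_within I f s <->
  forall eps : R, 0 < eps -> exists delta : R, 0 < delta /\
    forall y : R, I y -> Rabs (y - s) < delta -> Rabs (f y - f s) < eps.
Proof.
split.
- intros H eps Heps.
  destruct (H (fun z => Rabs (z - f s) < eps)) as [d Hd].
  { exists (mkposreal eps Heps). intros z Hz. exact Hz. }
  exists d. split; [apply cond_pos|]. intros y Hy Hys. apply Hd; assumption.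
- intros H P [eps HP]. destruct (H eps (cond_pos eps)) as [d [Hd H']].
  exists (mkposreal d Hd). intros y Hy Iy. apply HP. apply H'; assumption.
Qed.

Lemma continuous_within_ext (I : R -> Prop) (f g : R -> R) (s : R) :
  I s -> (forall y, I y -> f y = g y) -> continuous_within I f s -> continuous_within I g s.
Proof.
intros Hs E. rewrite !continuous_within_eps. intros H eps Heps.
destruct (H eps Heps) as [d [Hd H']]. exists d. split; [exact Hd|].
intros y Iy Hy. rewrite <- !E by assumption. now apply H'.
Qed.

Lemma continuous_within_comp (I J : R -> Prop) (f h : R -> R) (s : R) :
  (forall t, J t -> I (h t)) ->
  continuous_within J h s -> continuous_within I f (h s) -> continuous_within J (fun t => f (h t)) s.
Proof.
intros HJ. rewrite !continuous_within_eps. intros Hh Hf eps Heps.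
destruct (Hf eps Heps) as [d [Hd H1]]. destruct (Hh d Hd) as [e [He H2]].
exists e. split; [exact He|]. intros y Jy Hy. auto.
Qed.

Lemma continuous_within_of_continuous (I : R -> Prop) (f : R -> R) (s : R) :
  continuous f s -> continuous_within I f s.
Proof.
intros H P HP. destruct (H P HP) as [d Hd]. exists d. intros y Hy _. now apply Hd.
Qed.

Lemma continuous_within_const (I : R -> Prop) (c s : R) : continuous_within I (fun _ => c) s.
Proof. apply continuous_within_of_continuous, continuous_const. Qed.

Lemma continuous_within_plus (I : R -> Prop) (f g : R -> R) (s : R) :
  continuous_within I f s -> continuous_within I g s -> continuous_within I (fun y => f y + g y) s.
Proof.
intros Hf Hg. unfold continuous_within.
apply (filterlim_comp_2 f g Rplus Hf Hg (filterlim_plus (f s) (g s))).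
Qed.

Lemma continuous_within_mult (I : R -> Prop) (f g : R -> R) (s : R) :
  continuous_within I f s -> continuous_within I g s -> continuous_within I (fun y => f y * g y) s.
Proof.
intros Hf Hg. unfold continuous_within.
apply (filterlim_comp_2 f g Rmult Hf Hg
  (@filterlim_mult R_AbsRing (f s) (g s))).
Qed.

Lemma continuous_within_opp (I : R -> Prop) (f : R -> R) (s : R) :
  continuous_within I f s -> continuous_within I (fun y => - f y) s.
Proof.
intros Hf. apply (filterlim_comp _ _ _ f Ropp _ _ _ Hf (filterlim_opp (f s))).
Qed.

Lemma continuous_within_minus (I : R -> Prop) (f g : R -> R) (s : R) :
  continuous_within I f s -> continuous_within I g s -> continuous_within I (fun y => f y - g y) s.
Proof. intros Hf Hg. apply continuous_within_plus; [exact Hf|]. now apply continuous_within_opp. Qed.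

Lemma continuous_within_inv (I : R -> Prop) (f : R -> R) (s : R) :
  continuous_within I f s -> f s <> 0 -> continuous_within I (fun y => / f y) s.
Proof.
intros Hf Hs.
apply (filterlim_comp _ _ _ f Rinv _ _ _ Hf).
apply continuous_Rinv, Hs.
Qed.

Lemma derive_on_eps {V : NormedModule R_AbsRing} (I : R -> Prop) (f : R -> V)
    (s : R) (l : V) : I s ->
  is_derive_on I f s l <->
  (forall eps : R, 0 < eps -> exists delta : R, 0 < delta /\
    forall y : R, I y -> Rabs (y - s) < delta ->
      norm (minus (minus (f y) (f s)) (scal (y - s) l)) <= eps * Rabs (y - s)).
Proof.
intros Is. split.
- intros [_ H] eps Heps.
  destruct (H s) with (eps := mkposreal eps Heps) as [d Hd].
  { intros P [d HP]. exists d. intros y Hy _. now apply HP. }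
  exists d. split; [apply cond_pos|]. intros y Iy Hy. now apply Hd.
- intros H. split; [exact (@is_linear_scal_l R_AbsRing _ _)|].
  intros x Hx.
  assert (x = s) as ->.
  { apply NNPP. intros Hne.
    assert (HP : locally x (fun y => y <> s)).
    { assert (Hp : 0 < Rabs (s - x)) by (apply Rabs_pos_lt; lra).
      exists (mkposreal _ Hp). intros y Hy ->.
      apply (Rlt_irrefl (Rabs (s - x))). exact Hy. }
    destruct (Hx _ HP) as [d Hd]. apply (Hd s); [apply ball_center|exact Is|reflexivity]. }
  intros [eps Heps]. destruct (H eps Heps) as [d [Hd H']].
  exists (mkposreal d Hd). intros y Hy Iy. now apply H'.
Qed.

(** Caratheodory's form of differentiability: the difference quotient extends
    continuously to [s].  It turns every rule below, the chain rule and the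
    derivative of an inverse included, into a statement about continuity. *)
Lemma der_slope (I : R -> Prop) (f : R -> R) (s l : R) : I s ->
  der I f s l <->
  exists g : R -> R, g s = l /\ continuous_within I g s /\
    forall y, I y -> f y - f s = g y * (y - s).
Proof.
intros Is. rewrite (derive_on_eps I f s l Is). split.
- intros H.
  exists (fun y => if Req_EM_T y s then l else (f y - f s) / (y - s)).
  destruct (Req_EM_T s s) as [_|]; [|congruence].
  split; [reflexivity|]. split.
  + apply continuous_within_eps. intros eps Heps. destruct (H (eps / 2)) as [d [Hd H']]; [lra|].
    exists d. split; [exact Hd|]. intros y Iy Hy.
    destruct (Req_EM_T s s) as [_|]; [|congruence].
    destruct (Req_EM_T y s) as [->|Hn].
    * rewrite Rminus_diag, Rabs_R0. exact Heps.
    * specialize (H' y Iy Hy).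
      change (Rabs (f y - f s - (y - s) * l) <= eps / 2 * Rabs (y - s)) in H'.
      replace (f y - f s - (y - s) * l)
        with (((f y - f s) / (y - s) - l) * (y - s)) in H' by (field; lra).
      rewrite Rabs_mult in H'.
      apply Rmult_le_reg_r in H'; [lra|apply Rabs_pos_lt; lra].
  + intros y Iy. destruct (Req_EM_T y s) as [->|Hn]; [ring|field; lra].
- intros [g [<- [Hg E]]] eps Heps. rewrite continuous_within_eps in Hg.
  destruct (Hg eps Heps) as [d [Hd H']]. exists d. split; [exact Hd|].
  intros y Iy Hy.
  change (Rabs (f y - f s - (y - s) * g s) <= eps * Rabs (y - s)).
  rewrite E by exact Iy.
  replace (g y * (y - s) - (y - s) * g s) with ((g y - g s) * (y - s)) by ring.
  rewrite Rabs_mult. apply Rmult_le_compat_r; [apply Rabs_pos|].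
  apply Rlt_le, H'; assumption.
Qed.

Lemma der_continuous_within (I : R -> Prop) (f : R -> R) (s l : R) :
  I s -> der I f s l -> continuous_within I f s.
Proof.
intros Is H. apply der_slope in H as [g [_ [Hg E]]]; [|exact Is].
apply (continuous_within_ext I (fun y => f s + g y * (y - s))); [exact Is| |].
- intros y Iy. rewrite <- E by exact Iy. ring.
- apply continuous_within_plus; [apply continuous_within_const|]. apply continuous_within_mult; [exact Hg|].
  apply continuous_within_of_continuous.
  apply (continuous_minus (fun y : R => y)); [apply continuous_id|apply continuous_const].
Qed.

Lemma der_ext (I : R -> Prop) (f g : R -> R) (s l : R) : I s ->
  (forall y, I y -> f y = g y) -> der I f s l -> der I g s l.
Proof.
intros Is E H. apply der_slope in H as [h [H1 [H2 H3]]]; [|exact Is].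
apply der_slope; [exact Is|]. exists h. split; [exact H1|]. split; [exact H2|].
intros y Iy. rewrite <- !E by assumption. now apply H3.
Qed.

(** Antiderivatives are computed on compact pieces of [I]; locality carries their
    derivatives over to [I]. *)
Lemma der_ext_near (I : R -> Prop) (f g : R -> R) (s l delta : R) :
  I s -> 0 < delta ->
  (forall y, I y -> Rabs (y - s) < delta -> f y = g y) ->
  der I f s l -> der I g s l.
Proof.
intros Is Hd E. rewrite !(derive_on_eps I) by exact Is. intros H eps Heps.
destruct (H eps Heps) as [d [Hd' H']].
exists (Rmin d delta). split; [now apply Rmin_glb_lt|].
intros y Iy Hy.
assert (Rabs (y - s) < d) by (eapply Rlt_le_trans; [exact Hy|apply Rmin_l]).
assert (Rabs (y - s) < delta) by (eapply Rlt_le_trans; [exact Hy|apply Rmin_r]).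
rewrite <- !E; auto. rewrite Rminus_diag, Rabs_R0. exact Hd.
Qed.

Lemma der_of_is_derive (I : R -> Prop) (f : R -> R) (s l : R) : I s ->
  is_derive f s l -> der I f s l.
Proof.
intros Is [_ H]. apply (derive_on_eps I); [exact Is|]. intros eps Heps.
destruct (H s) with (eps := mkposreal eps Heps) as [d Hd]; [intros P HP; exact HP|].
exists d. split; [apply cond_pos|]. intros y _ Hy. now apply Hd.
Qed.

Lemma der_const (I : R -> Prop) (c s : R) : I s -> der I (fun _ => c) s 0.
Proof. intros Is. apply der_of_is_derive; [exact Is|]. apply (@is_derive_const R_AbsRing R_NormedModule). Qed.

Lemma der_plus (I : R -> Prop) (f g : R -> R) (s l m : R) : I s ->
  der I f s l -> der I g s m -> der I (fun y => f y + g y) s (l + m).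
Proof.
intros Is Hf Hg. apply der_slope in Hf as [h [H1 [H2 H3]]]; [|exact Is].
apply der_slope in Hg as [k [K1 [K2 K3]]]; [|exact Is].
apply der_slope; [exact Is|]. exists (fun y => h y + k y). split; [lra|].
split; [now apply continuous_within_plus|]. intros y Iy. specialize (H3 y Iy). specialize (K3 y Iy). lra.
Qed.

Lemma der_mult (I : R -> Prop) (f g : R -> R) (s l m : R) : I s ->
  der I f s l -> der I g s m -> der I (fun y => f y * g y) s (l * g s + f s * m).
Proof.
intros Is Hf Hg. assert (Cf := der_continuous_within _ _ _ _ Is Hf).
apply der_slope in Hf as [h [H1 [H2 H3]]]; [|exact Is].
apply der_slope in Hg as [k [K1 [K2 K3]]]; [|exact Is].
apply der_slope; [exact Is|]. exists (fun y => h y * g s + f y * k y). split; [now subst|].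
split.
- apply continuous_within_plus; apply continuous_within_mult; trivial. apply continuous_within_const.
- intros y Iy. specialize (H3 y Iy). specialize (K3 y Iy).
  replace (f y * g y - f s * g s) with ((f y - f s) * g s + f y * (g y - g s)) by ring.
  rewrite H3, K3. ring.
Qed.

Lemma der_comp (I J : R -> Prop) (f h : R -> R) (t l m : R) :
  (forall r, J r -> I (h r)) -> J t ->
  der J h t m -> der I f (h t) l -> der J (fun r => f (h r)) t (l * m).
Proof.
intros HJ Jt Hh Hf. assert (Ch := der_continuous_within _ _ _ _ Jt Hh).
apply der_slope in Hh as [k [K1 [K2 K3]]]; [|exact Jt].
apply der_slope in Hf as [g [H1 [H2 H3]]]; [|auto].
apply der_slope; [exact Jt|]. exists (fun r => g (h r) * k r). split; [now subst|].
split.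
- apply continuous_within_mult; [|exact K2]. now apply (continuous_within_comp I).
- intros r Jr. rewrite H3 by auto. rewrite K3 by exact Jr. ring.
Qed.

Lemma der_eq (I : R -> Prop) (f : R -> R) (s l m : R) :
  der I f s l -> l = m -> der I f s m.
Proof. intros H <-. exact H. Qed.

Lemma der_scal (I : R -> Prop) (f : R -> R) (c s l : R) : I s ->
  der I f s l -> der I (fun y => c * f y) s (c * l).
Proof.
intros Is H. eapply der_eq; [apply (der_mult I (fun _ => c)); [exact Is|now apply der_const|exact H]|].
ring.
Qed.

Lemma der_opp (I : R -> Prop) (f : R -> R) (s l : R) : I s ->
  der I f s l -> der I (fun y => - f y) s (- l).
Proof.
intros Is H. apply (der_ext I (fun y => (-1) * f y)); [exact Is|intros; ring|].
eapply der_eq; [now apply der_scal, H|ring].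
Qed.

Lemma der_minus (I : R -> Prop) (f g : R -> R) (s l m : R) : I s ->
  der I f s l -> der I g s m -> der I (fun y => f y - g y) s (l - m).
Proof. intros Is Hf Hg. apply der_plus; trivial. now apply der_opp. Qed.

Lemma der_comp_out (I : R -> Prop) (f h : R -> R) (s l m : R) : I s ->
  der I h s m -> is_derive f (h s) l -> der I (fun r => f (h r)) s (l * m).
Proof.
intros Is Hh Hf. apply (der_comp (fun _ => True) I); auto.
now apply der_of_is_derive.
Qed.

Lemma interval_inhabited (I : R -> Prop) : interval I -> exists s, I s.
Proof. intros [_ [a [_ [Ia _]]]]. now exists a. Qed.

Lemma interval_near (I : R -> Prop) (s delta : R) : interval I -> I s ->
  0 < delta -> exists y, I y /\ y <> s /\ Rabs (y - s) < delta.
Proof.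
intros [Hc [a [b [Ia [Ib Hab]]]]] Is Hd.
destruct (Rlt_dec a s) as [Has|Has].
- exists (Rmax a (s - delta / 2)).
  assert (E1 := Rmax_l a (s - delta / 2)). assert (E2 := Rmax_r a (s - delta / 2)).
  assert (E3 : Rmax a (s - delta / 2) < s) by (apply Rmax_lub_lt; lra).
  split; [apply (Hc a _ s); trivial; lra|]. split; [lra|]. rewrite Rabs_left; lra.
- exists (Rmin b (s + delta / 2)).
  assert (E1 := Rmin_l b (s + delta / 2)). assert (E2 := Rmin_r b (s + delta / 2)).
  assert (E3 : s < Rmin b (s + delta / 2)) by (apply Rmin_glb_lt; lra).
  split; [apply (Hc s _ b); trivial; lra|]. split; [lra|]. rewrite Rabs_right; lra.
Qed.

(** Nondegeneracy of the interval enters here: [s] is a limit of other points of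
    [I], so the two slopes agree arbitrarily close to [s]. *)
Lemma der_unique (I : R -> Prop) (f : R -> R) (s l m : R) : interval I -> I s ->
  der I f s l -> der I f s m -> l = m.
Proof.
intros HI Is Hf Hg. apply der_slope in Hf as [h [H1 [H2 H3]]]; [|exact Is].
apply der_slope in Hg as [k [K1 [K2 K3]]]; [|exact Is].
apply NNPP. intros Hne.
assert (Hlm : 0 < Rabs (l - m)) by (apply Rabs_pos_lt; lra).
assert (Hl := continuous_within_minus I h k s H2 K2). rewrite continuous_within_eps in Hl.
destruct (Hl _ Hlm) as [d [Hd H]].
destruct (interval_near I s d HI Is Hd) as [y [Iy [Hy Hyd]]].
specialize (H y Iy Hyd).
assert (E : h y = k y).
{ apply (Rmult_eq_reg_r (y - s)); [|lra]. rewrite <- H3, <- K3; trivial. }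
rewrite E, H1, K1, Rminus_diag, Rminus_0_l, Rabs_Ropp in H. lra.
Qed.

(** * Mean value theorem, intermediate values and antiderivatives *)

Definition clamp (a b y : R) : R := Rmax a (Rmin b y).

Lemma clamp_in (a b y : R) : a <= b -> a <= clamp a b y <= b.
Proof. intros H. unfold clamp. split; [apply Rmax_l|]. apply Rmax_lub; [exact H|apply Rmin_l]. Qed.

Lemma clamp_id (a b y : R) : a <= y <= b -> clamp a b y = y.
Proof. intros H. unfold clamp. rewrite Rmin_right by lra. apply Rmax_right. lra. Qed.

Lemma clamp_lip (a b y z : R) : Rabs (clamp a b y - clamp a b z) <= Rabs (y - z).
Proof.
unfold clamp, Rmax, Rmin.
destruct (Rle_dec b y), (Rle_dec b z); repeat destruct Rle_dec;
  unfold Rabs; repeat destruct Rcase_abs; lra.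
Qed.

(** Precomposing with [clamp a b] turns a function that is continuous along [I]
    into one that is continuous on the whole line, to which the classical theorems
    on compact intervals apply. *)
Lemma continuous_clamp (I : R -> Prop) (f : R -> R) (a b : R) :
  interval I -> I a -> I b -> a <= b ->
  (forall s, I s -> continuous_within I f s) ->
  forall y, continuous (fun z => f (clamp a b z)) y.
Proof.
intros [Hc _] Ia Ib Hab Hf y.
assert (HI : forall z, I (clamp a b z)).
{ intros z. apply (Hc a _ b); trivial. now apply clamp_in. }
assert (H : continuous_within (fun _ => True) (fun z => f (clamp a b z)) y).
{ apply (continuous_within_comp I); [auto| |auto].
  apply continuous_within_eps. intros eps Heps. exists eps. split; [exact Heps|].
  intros z _ Hz. eapply Rle_lt_trans; [apply clamp_lip|exact Hz]. }
intros P HP. destruct (H P HP) as [d Hd]. exists d. intros z Hz. now apply Hd.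
Qed.

Lemma mvt_on (I : R -> Prop) (f df : R -> R) (a b : R) :
  interval I -> I a -> I b -> a < b -> (forall s, I s -> der I f s (df s)) ->
  exists c, a <= c <= b /\ f b - f a = df c * (b - a).
Proof.
intros HI Ia Ib Hab Hf.
destruct (MVT_gen (fun z => f (clamp a b z)) a b df) as [c [Hc E]].
- rewrite Rmin_left, Rmax_right by lra. intros y Hy.
  assert (Iy : I y) by (apply (proj1 HI a y b); trivial; lra).
  assert (H := Hf y Iy). rewrite (derive_on_eps I) in H by exact Iy.
  split; [exact (@is_linear_scal_l R_AbsRing _ _)|]. intros x Hx.
  apply (@is_filter_lim_locally_unique R_AbsRing (AbsRing_NormedModule R_AbsRing)) in Hx.
  subst x.
  intros [eps Heps]. destruct (H eps Heps) as [d [Hd H']].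
  assert (Hp : 0 < Rmin d (Rmin (y - a) (b - y))) by (repeat apply Rmin_glb_lt; lra).
  exists (mkposreal _ Hp). intros z Hz.
  change (Rabs (z - y) < Rmin d (Rmin (y - a) (b - y))) in Hz.
  assert (E1 := Rmin_l d (Rmin (y - a) (b - y))).
  assert (E2 := Rmin_r d (Rmin (y - a) (b - y))).
  assert (E3 := Rmin_l (y - a) (b - y)). assert (E4 := Rmin_r (y - a) (b - y)).
  assert (E5 : a <= z <= b) by (apply Rabs_def2 in Hz; lra).
  rewrite !clamp_id by lra.
  apply H'; [apply (proj1 HI a z b); trivial|lra].
- intros y _. apply continuity_pt_filterlim.
  apply (continuous_clamp I); trivial; [lra|].
  intros s Is. apply (der_continuous_within I f s (df s)); auto.
- rewrite Rmin_left, Rmax_right in Hc by lra. exists c. split; [exact Hc|].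
  rewrite !clamp_id in E by lra. exact E.
Qed.

Lemma constant_on (I : R -> Prop) (f : R -> R) : interval I ->
  (forall s, I s -> der I f s 0) -> forall a b, I a -> I b -> f a = f b.
Proof.
intros HI Hf.
assert (H : forall a b, I a -> I b -> a < b -> f a = f b).
{ intros a b Ia Ib Hab.
  destruct (mvt_on I f (fun _ => 0) a b) as [c [_ E]]; trivial. lra. }
intros a b Ia Ib. destruct (Rtotal_order a b) as [Hlt|[->|Hlt]]; [auto|reflexivity|].
symmetry. auto.
Qed.

Lemma ivt_on (I : R -> Prop) (f : R -> R) (a b v : R) : interval I -> I a -> I b ->
  (forall s, I s -> continuous_within I f s) -> f a < v -> v < f b ->
  exists c, I c /\ f c = v.
Proof.
intros HI Ia Ib Hf Ha Hb.
set (lo := Rmin a b). set (hi := Rmax a b).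
assert (Hlh : lo <= hi) by apply Rminmax.
assert (Ilo : I lo) by (unfold lo, Rmin; destruct Rle_dec; assumption).
assert (Ihi : I hi) by (unfold hi, Rmax; destruct Rle_dec; assumption).
assert (Ca : lo <= a <= hi) by (split; [apply Rmin_l|apply Rmax_l]).
assert (Cb : lo <= b <= hi) by (split; [apply Rmin_r|apply Rmax_r]).
destruct (IVT_gen (fun z => f (clamp lo hi z)) a b v) as [c [_ E]].
- intros y. apply continuity_pt_filterlim. now apply (continuous_clamp I).
- rewrite !clamp_id by assumption. rewrite Rmin_left, Rmax_right by lra. lra.
- exists (clamp lo hi c). split; [|exact E].
  apply (proj1 HI lo _ hi); trivial. now apply clamp_in.
Qed.

Lemma pos_of_nonzero_on (I : R -> Prop) (f : R -> R) (a : R) : interval I -> I a ->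
  (forall s, I s -> continuous_within I f s) -> (forall s, I s -> f s <> 0) -> 0 < f a ->
  forall b, I b -> 0 < f b.
Proof.
intros HI Ia Hf Hn Ha b Ib.
destruct (Rtotal_order 0 (f b)) as [H|[H|H]]; [exact H| |].
- exfalso. now apply (Hn b Ib).
- exfalso. destruct (ivt_on I f b a 0) as [c [Ic E]]; trivial. now apply (Hn c Ic).
Qed.

(** A compact piece of [I] that contains [s0] and is a neighbourhood of [s] in [I].
    If [s] is an endpoint of [I], it is also an endpoint of the piece. *)
Lemma compact_near (I : R -> Prop) (s0 s : R) : interval I -> I s0 -> I s ->
  exists a b delta, I a /\ I b /\ a <= s0 <= b /\ a <= s <= b /\ 0 < delta /\
    forall y, I y -> Rabs (y - s) < delta -> a <= y <= b.
Proof.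
intros [Hc _] I0 Is.
assert (Hb : exists b db, I b /\ s0 <= b /\ s <= b /\ 0 < db /\
   forall y, I y -> y < s + db -> y <= b).
{ destruct (classic (exists y, I y /\ s < y)) as [[y [Iy Hy]]|Hn].
  - exists (Rmax y s0), (y - s). assert (E1 := Rmax_l y s0). assert (E2 := Rmax_r y s0).
    split; [unfold Rmax; destruct Rle_dec; assumption|]. repeat split; try lra.
    intros z _ Hz. lra.
  - exists s, 1. assert (Hle : forall y, I y -> y <= s).
    { intros y Iy. apply Rnot_lt_le. intros Hy. apply Hn. now exists y. }
    repeat split; auto; try lra. }
assert (Ha : exists a da, I a /\ a <= s0 /\ a <= s /\ 0 < da /\
   forall y, I y -> s - da < y -> a <= y).
{ destruct (classic (exists y, I y /\ y < s)) as [[y [Iy Hy]]|Hn].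
  - exists (Rmin y s0), (s - y). assert (E1 := Rmin_l y s0). assert (E2 := Rmin_r y s0).
    split; [unfold Rmin; destruct Rle_dec; assumption|]. repeat split; try lra.
    intros z _ Hz. lra.
  - exists s, 1. assert (Hle : forall y, I y -> s <= y).
    { intros y Iy. apply Rnot_lt_le. intros Hy. apply Hn. now exists y. }
    repeat split; auto; try lra. }
destruct Hb as [b [db [Ib [B1 [B2 [B3 B4]]]]]].
destruct Ha as [a [da [Ia [A1 [A2 [A3 A4]]]]]].
exists a, b, (Rmin da db). assert (E1 := Rmin_l da db). assert (E2 := Rmin_r da db).
repeat split; trivial; try lra; try now apply Rmin_glb_lt.
- apply Rabs_def2 in H0. apply A4; trivial. lra.
- apply Rabs_def2 in H0. apply B4; trivial. lra.
Qed.

(** A continuous function on [I] may be unbounded near an endpoint outside [I], so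
    it cannot be extended once and for all: near each [s] the integral is computed
    with the extension of the restriction to a compact piece. *)
Lemma antiderivative_on (I : R -> Prop) (f : R -> R) (s0 : R) : interval I -> I s0 ->
  (forall s, I s -> continuous_within I f s) ->
  exists F, F s0 = 0 /\ forall s, I s -> der I F s (f s).
Proof.
intros HI I0 Hf. exists (fun s => RInt f s0 s). split; [exact (RInt_point s0 f)|].
intros s Is.
destruct (compact_near I s0 s HI I0 Is) as [a [b [d [Ia [Ib [H0 [Hs [Hd H]]]]]]]].
assert (Hab : a <= b) by lra.
assert (Hc := continuous_clamp I f a b HI Ia Ib Hab Hf).
apply (der_ext_near I (fun y => RInt (fun z => f (clamp a b z)) s0 y) _ s (f s) d Is Hd).
- intros y Iy Hy. apply RInt_ext. intros z Hz. f_equal. apply clamp_id.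
  specialize (H y Iy Hy). revert Hz. unfold Rmin, Rmax; repeat destruct Rle_dec; lra.
- apply der_of_is_derive; [exact Is|].
  replace (f s) with (f (clamp a b s)) by (now rewrite clamp_id).
  apply (is_derive_RInt (fun z => f (clamp a b z)) _ s0); [|apply Hc].
  apply filter_forall. intros y. apply (@RInt_correct R_CompleteNormedModule).
  apply (@ex_RInt_continuous R_CompleteNormedModule). intros z _. apply Hc.
Qed.

(** With [H] an antiderivative of [h], the function [g e^(-H)] is constant. *)
Lemma zero_of_linear_ode (I : R -> Prop) (g h : R -> R) (s1 : R) : interval I -> I s1 ->
  (forall s, I s -> continuous_within I h s) -> (forall s, I s -> der I g s (h s * g s)) ->
  g s1 = 0 -> forall s, I s -> g s = 0.
Proof.
intros HI I1 Hh Hg E s Is.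
destruct (antiderivative_on I h s1 HI I1 Hh) as [H [_ HH]].
assert (K : g s * exp (- H s) = g s1 * exp (- H s1)).
{ apply (constant_on I (fun y => g y * exp (- H y))); trivial. intros y Iy.
  eapply der_eq.
  - apply der_mult; [exact Iy|now apply Hg|].
    apply (der_comp_out I exp (fun z => - H z) y (exp (- H y)) (- h y)); [exact Iy| |apply is_derive_exp].
    apply der_opp; auto.
  - cbv beta. ring. }
rewrite E, Rmult_0_l in K. apply Rmult_integral in K as [K|K]; [exact K|].
assert (P := exp_pos (- H s)). lra.
Qed.

(** The inverse of a strictly increasing function on an interval is continuous, and
    the slope of the inverse is the inverse of the slope. *)
Lemma inverse_derivative (I J : R -> Prop) (L f sigma : R -> R) : interval I ->
  (forall s, I s -> der I L s (f s)) -> (forall s, I s -> 0 < f s) ->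
  (forall t, J t -> I (sigma t) /\ L (sigma t) = t) ->
  forall t, J t -> der J sigma t (/ f (sigma t)).
Proof.
intros HI HL Hf Hsig t Jt.
assert (Hinc : forall a b, I a -> I b -> a < b -> L a < L b).
{ intros a b Ia Ib Hab. destruct (mvt_on I L f a b) as [c [Hc E]]; trivial.
  assert (0 < f c) by (apply Hf, (proj1 HI a c b); trivial). nra. }
destruct (Hsig t Jt) as [Is Et].
assert (Csig : continuous_within J sigma t).
{ apply continuous_within_eps. intros eps Heps.
  assert (Hup : exists d, 0 < d /\ forall r, J r -> r < t + d -> sigma r < sigma t + eps).
  { destruct (classic (I (sigma t + eps))) as [Iu|Nu].
    - exists (L (sigma t + eps) - t). assert (Hi := Hinc _ _ Is Iu). split; [lra|].
      intros r Jr Hr. apply Rnot_le_lt. intros Hge. destruct (Hsig r Jr) as [Ir Er].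
      destruct (Rle_lt_or_eq_dec _ _ Hge) as [Hlt|Heq].
      + assert (Hi' := Hinc _ _ Iu Ir Hlt). lra.
      + rewrite Heq in Hr. lra.
    - exists 1. split; [lra|]. intros r Jr _. apply Rnot_le_lt. intros Hge. apply Nu.
      apply (proj1 HI (sigma t) _ (sigma r)); trivial; [apply Hsig, Jr|lra]. }
  assert (Hlo : exists d, 0 < d /\ forall r, J r -> t - d < r -> sigma t - eps < sigma r).
  { destruct (classic (I (sigma t - eps))) as [Iu|Nu].
    - exists (t - L (sigma t - eps)). assert (Hi := Hinc (sigma t - eps) (sigma t) Iu Is ltac:(lra)).
      split; [lra|].
      intros r Jr Hr. apply Rnot_le_lt. intros Hge. destruct (Hsig r Jr) as [Ir Er].
      destruct (Rle_lt_or_eq_dec _ _ Hge) as [Hlt|Heq].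
      + assert (Hi' := Hinc _ _ Ir Iu Hlt). lra.
      + rewrite <- Heq in Hr. lra.
    - exists 1. split; [lra|]. intros r Jr _. apply Rnot_le_lt. intros Hge. apply Nu.
      apply (proj1 HI (sigma r) _ (sigma t)); trivial; [apply Hsig, Jr|lra]. }
  destruct Hup as [d1 [Hd1 U]]. destruct Hlo as [d2 [Hd2 W]].
  exists (Rmin d1 d2). split; [now apply Rmin_glb_lt|]. intros r Jr Hr.
  assert (E1 := Rmin_l d1 d2). assert (E2 := Rmin_r d1 d2). apply Rabs_def2 in Hr.
  specialize (U r Jr ltac:(lra)). specialize (W r Jr ltac:(lra)). apply Rabs_def1; lra. }
assert (D := HL _ Is). apply der_slope in D as [g [G1 [G2 G3]]]; [|exact Is].
apply der_slope; [exact Jt|]. exists (fun r => / g (sigma r)). split; [now rewrite G1|].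
split.
- apply continuous_within_inv; [now apply (continuous_within_comp I); [intros r Jr; apply Hsig| |]|].
  rewrite G1. specialize (Hf _ Is). lra.
- intros r Jr. destruct (Hsig r Jr) as [Ir Er]. specialize (G3 _ Ir). rewrite Er, Et in G3.
  rewrite G3. destruct (Req_dec (g (sigma r)) 0) as [Z|Z]; [|field; exact Z].
  rewrite Z, Rmult_0_l in G3. assert (r = t) as -> by lra. rewrite G1 in Z.
  specialize (Hf _ Is). lra.
Qed.

(** * Functions of class C^k *)

Notation class k I f := (@of_class R_NormedModule k I f).
Notation smooth I f := (@smooth_on R_NormedModule I f).
Notation deriv I f := (@Defs.D R_CompleteNormedModule I f).

Lemma class_ext (k : nat) (I : R -> Prop) (f g : R -> R) :
  (forall y, I y -> f y = g y) -> class k I f -> class k I g.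
Proof.
destruct k as [|k]; intros E H.
- intros s Is. exact (continuous_within_ext I f g s Is E (H s Is)).
- destruct H as [f' [H1 H2]]. exists f'. split; [|exact H2].
  intros s Is. apply (der_ext I f g s (f' s) Is E). now apply H1.
Qed.

Lemma class_pred (k : nat) (I : R -> Prop) (f : R -> R) : class (S k) I f -> class k I f.
Proof.
revert f. induction k as [|k IH]; intros f [f' [H1 H2]].
- intros s Is. exact (der_continuous_within I f s (f' s) Is (H1 s Is)).
- exists f'. split; [exact H1|now apply IH].
Qed.

Lemma class_const (k : nat) (I : R -> Prop) (c : R) : class k I (fun _ => c).
Proof.
revert c. induction k as [|k IH]; intros c.
- intros s _. exact (continuous_within_const I c s).
- exists (fun _ => 0). split; [|apply IH]. intros s Is. now apply der_const.
Qed.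

Lemma class_plus (k : nat) (I : R -> Prop) (f g : R -> R) :
  class k I f -> class k I g -> class k I (fun y => f y + g y).
Proof.
revert f g. induction k as [|k IH]; intros f g Hf Hg.
- intros s Is. exact (continuous_within_plus I f g s (Hf s Is) (Hg s Is)).
- destruct Hf as [f' [F1 F2]]. destruct Hg as [g' [G1 G2]].
  exists (fun y => f' y + g' y). split; [|now apply IH].
  intros s Is. apply der_plus; auto.
Qed.

Lemma class_mult (k : nat) (I : R -> Prop) (f g : R -> R) :
  class k I f -> class k I g -> class k I (fun y => f y * g y).
Proof.
revert f g. induction k as [|k IH]; intros f g Hf Hg.
- intros s Is. exact (continuous_within_mult I f g s (Hf s Is) (Hg s Is)).
- assert (Cf := class_pred _ _ _ Hf). assert (Cg := class_pred _ _ _ Hg).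
  destruct Hf as [f' [F1 F2]]. destruct Hg as [g' [G1 G2]].
  exists (fun y => f' y * g y + f y * g' y). split.
  + intros s Is. apply der_mult; auto.
  + apply class_plus; now apply IH.
Qed.

Lemma class_comp (k : nat) (I J : R -> Prop) (f h : R -> R) :
  (forall t, J t -> I (h t)) -> class k I f -> class k J h ->
  class k J (fun t => f (h t)).
Proof.
intros HJ. revert f. induction k as [|k IH]; intros f Hf Hh.
- intros t Jt. exact (continuous_within_comp I J f h t HJ (Hh t Jt) (Hf (h t) (HJ t Jt))).
- assert (Ch := class_pred _ _ _ Hh).
  destruct Hf as [f' [F1 F2]]. destruct Hh as [h' [G1 G2]].
  exists (fun t => f' (h t) * h' t). split.
  + intros t Jt. apply (der_comp I J); auto.
  + apply class_mult; [now apply IH|exact G2].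
Qed.

Lemma class_opp (k : nat) (I : R -> Prop) (f : R -> R) :
  class k I f -> class k I (fun y => - f y).
Proof.
intros H. apply (class_ext _ _ (fun y => (-1) * f y)); [intros; ring|].
now apply class_mult; [apply class_const|].
Qed.

(** The real powers of a positive number are stable under differentiation up to
    constants; with composition they give the smoothness of the modulus of a
    nowhere vanishing velocity and of its reciprocal. *)
Lemma class_Rpower (k : nat) (a : R) : class k (fun y => 0 < y) (fun y => Rpower y a).
Proof.
revert a. induction k as [|k IH]; intros a.
- intros y Hy. refine (der_continuous_within _ (fun z => Rpower z a) y (a * Rpower y (a - 1)) Hy _).
  apply der_of_is_derive; [exact Hy|]. apply is_derive_Reals.
  now apply derivable_pt_lim_power.
- exists (fun y => a * Rpower y (a - 1)). split.
  + intros y Hy. apply der_of_is_derive; [exact Hy|]. apply is_derive_Reals.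
    now apply derivable_pt_lim_power.
  + apply class_mult; [apply class_const|apply IH].
Qed.

Lemma deriv_eq (I : R -> Prop) (f : R -> R) (s l : R) : interval I -> I s ->
  der I f s l -> deriv I f s = l.
Proof.
intros HI Is H. apply (@iota_unique R_AbsRing R_CompleteNormedModule); [|exact H].
intros m Hm. now apply (der_unique I f s).
Qed.

Lemma smooth_der (I : R -> Prop) (f : R -> R) (s : R) : interval I -> smooth I f ->
  I s -> der I f s (deriv I f s).
Proof.
intros HI Hf Is. destruct (Hf 1%nat) as [f' [H _]].
rewrite (deriv_eq I f s (f' s)); auto.
Qed.

Lemma smooth_deriv (I : R -> Prop) (f : R -> R) : interval I -> smooth I f ->
  smooth I (deriv I f).
Proof.
intros HI Hf k. destruct (Hf (S k)) as [f' [H H']].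
apply (class_ext _ _ f'); [|exact H']. intros y Iy. symmetry. apply deriv_eq; auto.
Qed.

Lemma smooth_of_der (I : R -> Prop) (f f' : R -> R) :
  (forall s, I s -> der I f s (f' s)) -> smooth I f' -> smooth I f.
Proof.
intros H H' k. apply class_pred. exists f'. split; [exact H|apply H'].
Qed.

(** * Plane curves by coordinates *)

Notation curve_der I c s l := (@is_derive_on C_R_NormedModule I c s l).

Lemma curve_der_iff (I : R -> Prop) (c : R -> C) (s : R) (l : C) : I s ->
  curve_der I c s l <->
  der I (fun r => Re (c r)) s (Re l) /\ der I (fun r => Im (c r)) s (Im l).
Proof.
intros Is. rewrite !(derive_on_eps I) by exact Is.
set (N := fun y => sqrt (Rabs (Re (c y) - Re (c s) - (y - s) * Re l) ^ 2 +
         Rabs (Im (c y) - Im (c s) - (y - s) * Im l) ^ 2)).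
assert (B : forall a b, Rabs a <= sqrt (Rabs a ^ 2 + Rabs b ^ 2) /\
  Rabs b <= sqrt (Rabs a ^ 2 + Rabs b ^ 2) /\
  sqrt (Rabs a ^ 2 + Rabs b ^ 2) <= Rabs a + Rabs b).
{ intros a b. assert (Ha := Rabs_pos a). assert (Hb := Rabs_pos b).
  split; [|split].
  - rewrite <- (sqrt_pow2 (Rabs a)) at 1 by exact Ha. apply sqrt_le_1_alt. nra.
  - rewrite <- (sqrt_pow2 (Rabs b)) at 1 by exact Hb. apply sqrt_le_1_alt. nra.
  - rewrite <- (sqrt_pow2 (Rabs a + Rabs b)) by lra. apply sqrt_le_1_alt. nra. }
split.
- intros H. split; intros eps Heps; destruct (H eps Heps) as [d [Hd H']];
    exists d; (split; [exact Hd|]); intros y Iy Hy; specialize (H' y Iy Hy);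
    change (N y <= eps * Rabs (y - s)) in H'; (eapply Rle_trans; [|exact H']); apply B.
- intros [H1 H2] eps Heps.
  destruct (H1 (eps / 2)) as [d1 [D1 K1]]; [lra|].
  destruct (H2 (eps / 2)) as [d2 [D2 K2]]; [lra|].
  exists (Rmin d1 d2). split; [now apply Rmin_glb_lt|]. intros y Iy Hy.
  assert (E1 := Rmin_l d1 d2). assert (E2 := Rmin_r d1 d2).
  specialize (K1 y Iy ltac:(lra)). specialize (K2 y Iy ltac:(lra)).
  change (N y <= eps * Rabs (y - s)). eapply Rle_trans; [apply B|].
  change (Rabs (Re (c y) - Re (c s) - (y - s) * Re l) <= eps / 2 * Rabs (y - s)) in K1.
  change (Rabs (Im (c y) - Im (c s) - (y - s) * Im l) <= eps / 2 * Rabs (y - s)) in K2.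
  lra.
Qed.

Lemma vel_eq (I : R -> Prop) (c : R -> C) (s : R) (l : C) : interval I -> I s ->
  curve_der I c s l -> vel I c s = l.
Proof.
intros HI Is H. apply (@iota_unique R_AbsRing C_R_CompleteNormedModule); [|exact H].
intros m Hm. apply curve_der_iff in H as [H1 H2]; [|exact Is].
apply curve_der_iff in Hm as [M1 M2]; [|exact Is].
apply injective_projections.
- apply (der_unique I (fun r => Re (c r)) s); trivial.
- apply (der_unique I (fun r => Im (c r)) s); trivial.
Qed.

Lemma class_curve (k : nat) (I : R -> Prop) (c : R -> C) :
  @of_class C_R_NormedModule k I c <->
  class k I (fun r => Re (c r)) /\ class k I (fun r => Im (c r)).
Proof.
revert c. induction k as [|k IH]; intros c.
- split.
  + intros H. split; intros s Is P [e HP].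
    * apply (H s Is (fun z : C => P (Re z))). exists e. intros z [Hz _]. now apply HP.
    * apply (H s Is (fun z : C => P (Im z))). exists e. intros z [_ Hz]. now apply HP.
  + intros [H1 H2] s Is P [e HP].
    destruct (H1 s Is (fun a => ball (Re (c s)) e a)) as [d1 D1]; [now exists e|].
    destruct (H2 s Is (fun a => ball (Im (c s)) e a)) as [d2 D2]; [now exists e|].
    assert (Hd : 0 < Rmin d1 d2) by (apply Rmin_glb_lt; apply cond_pos).
    exists (mkposreal _ Hd). intros y Hy Iy. apply HP. split.
    * apply D1; [|exact Iy]. eapply ball_le; [|exact Hy]. apply Rmin_l.
    * apply D2; [|exact Iy]. eapply ball_le; [|exact Hy]. apply Rmin_r.
- split.
  + intros [c' [H1 H2]]. apply IH in H2 as [K1 K2]. split.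
    * exists (fun r => Re (c' r)). split; [|exact K1]. intros s Is.
      apply (curve_der_iff I c s (c' s) Is). auto.
    * exists (fun r => Im (c' r)). split; [|exact K2]. intros s Is.
      apply (curve_der_iff I c s (c' s) Is). auto.
  + intros [[f [F1 F2]] [g [G1 G2]]]. exists (fun r => (f r, g r)). split.
    * intros s Is. apply curve_der_iff; [exact Is|]. split; [now apply F1|now apply G1].
    * apply IH. split; assumption.
Qed.

Lemma smooth_curve_iff (I : R -> Prop) (c : R -> C) : smooth_curve I c <->
  smooth I (fun r => Re (c r)) /\ smooth I (fun r => Im (c r)).
Proof.
split.
- intros H. split; intros k; now apply (class_curve k I c), H.
- intros [H1 H2] k. apply class_curve. now split.
Qed.

Lemma smooth_curve_der (I : R -> Prop) (c : R -> C) (s : R) : interval I ->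
  smooth_curve I c -> I s -> curve_der I c s (vel I c s).
Proof.
intros HI Hc Is. destruct (Hc 1%nat) as [c' [H _]].
rewrite (vel_eq I c s (c' s)); auto.
Qed.

Lemma smooth_vel (I : R -> Prop) (c : R -> C) : interval I -> smooth_curve I c ->
  smooth_curve I (vel I c).
Proof.
intros HI Hc. apply smooth_curve_iff in Hc as Hc'. destruct Hc' as [H1 H2].
apply smooth_curve_iff.
assert (E : forall s, I s -> deriv I (fun r => Re (c r)) s = Re (vel I c s) /\
                             deriv I (fun r => Im (c r)) s = Im (vel I c s)).
{ intros s Is. assert (Hv := smooth_curve_der I c s HI Hc Is).
  apply curve_der_iff in Hv as [V1 V2]; [|exact Is]. split; now apply deriv_eq. }
split; intros k.
- apply (class_ext k I (deriv I (fun r => Re (c r)))); [apply E|now apply smooth_deriv].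
- apply (class_ext k I (deriv I (fun r => Im (c r)))); [apply E|now apply smooth_deriv].
Qed.

Lemma vel_reparametrized (J I : R -> Prop) (sigma : R -> R) (c : R -> C) (t : R) :
  interval I -> reparametrization J I sigma -> smooth_curve I c -> J t ->
  vel J (fun r => c (sigma r)) t =
  (RtoC (deriv J sigma t) * vel I c (sigma t))%C.
Proof.
intros HI [HJ [Hs [HJI [_ _]]]] Hc Jt.
apply vel_eq; trivial.
assert (Hv := smooth_curve_der I c _ HI Hc (HJI t Jt)).
apply curve_der_iff in Hv as [V1 V2]; [|auto].
apply curve_der_iff; [exact Jt|].
assert (S := smooth_der J sigma t HJ Hs Jt).
split.
- eapply der_eq; [exact (der_comp I J _ sigma t _ _ HJI Jt S V1)|].
  unfold Re, Im, RtoC. simpl. ring.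
- eapply der_eq; [exact (der_comp I J _ sigma t _ _ HJI Jt S V2)|].
  unfold Re, Im, RtoC. simpl. ring.
Qed.

Lemma smooth_reparametrized (J I : R -> Prop) (sigma : R -> R) (c : R -> C) :
  reparametrization J I sigma -> smooth_curve I c ->
  smooth_curve J (fun r => c (sigma r)).
Proof.
intros [HJ [Hs [HJI _]]] Hc. apply smooth_curve_iff in Hc as [H1 H2].
apply smooth_curve_iff. split; intros k.
- exact (class_comp k I J _ sigma HJI (H1 k) (Hs k)).
- exact (class_comp k I J _ sigma HJI (H2 k) (Hs k)).
Qed.

(** * Arc-length parametrization *)

(** [sigma] inverts an antiderivative [L] of the speed, and [J] is the image of [L].
    Smoothness of [sigma] bootstraps: its derivative is the reciprocal speed composed
    with [sigma], hence is as regular as [sigma] itself. *)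
Lemma arc_length_reparametrization (I : R -> Prop) (c : R -> C) : interval I ->
  smooth_curve I c -> (forall s, I s -> vel I c s <> RtoC 0) ->
  exists J sigma, reparametrization J I sigma /\
    forall t, J t -> Cmod (RtoC (deriv J sigma t) * vel I c (sigma t))%C = 1.
Proof.
intros HI Hc Hn.
assert (Hp : forall s, I s -> 0 < Cmod (vel I c s)).
{ intros s Is. apply Cmod_gt_0. auto. }
destruct (proj1 (smooth_curve_iff _ _) (smooth_vel I c HI Hc)) as [U1 U2].
set (q := fun s => Re (vel I c s) * Re (vel I c s) + Im (vel I c s) * Im (vel I c s)).
assert (Q : forall s, Cmod (vel I c s) = sqrt (q s)).
{ intros s. unfold Cmod, q, Re, Im. f_equal. ring. }
assert (Qp : forall s, I s -> 0 < q s).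
{ intros s Is. specialize (Hp s Is). rewrite Q in Hp.
  apply sqrt_lt_0_alt. now rewrite sqrt_0. }
assert (Qs : smooth I q).
{ intros k. apply class_plus; apply class_mult; auto. }
assert (Sp : smooth I (fun s => Cmod (vel I c s))).
{ intros k. apply (class_ext k I (fun s => Rpower (q s) (/ 2))).
  - intros s Is. rewrite Q. apply Rpower_sqrt. auto.
  - apply (class_comp k (fun y => 0 < y) I (fun y => Rpower y (/ 2)) q); auto.
    apply class_Rpower. }
assert (Ip : smooth I (fun s => / Cmod (vel I c s))).
{ intros k. apply (class_ext k I (fun s => Rpower (Cmod (vel I c s)) (Ropp 1))).
  - intros s Is. rewrite Rpower_Ropp, Rpower_1; auto.
  - apply (class_comp k (fun y => 0 < y) I (fun y => Rpower y (Ropp 1))); auto.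
    apply class_Rpower. }
destruct (interval_inhabited I HI) as [s0 I0].
destruct (antiderivative_on I (fun s => Cmod (vel I c s)) s0 HI I0) as [L [_ HL]].
{ exact (Sp 0%nat). }
set (J := fun t => exists s, I s /\ L s = t).
assert (Hsig : exists sigma, forall t, J t -> I (sigma t) /\ L (sigma t) = t).
{ exists (fun t => epsilon (inhabits 0) (fun s => I s /\ L s = t)).
  intros t Jt. exact (epsilon_spec (inhabits 0) (fun s => I s /\ L s = t) Jt). }
destruct Hsig as [sigma Hsig].
assert (HD := inverse_derivative I J L _ sigma HI HL Hp Hsig).
assert (Linc : forall a b, I a -> I b -> a < b -> L a < L b).
{ intros a b Ia Ib Hab.
  destruct (mvt_on I L (fun s => Cmod (vel I c s)) a b) as [d [Hd E]]; trivial.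
  assert (0 < Cmod (vel I c d)) by (apply Hp, (proj1 HI a d b); trivial). nra. }
assert (HJ : interval J).
{ split.
  - intros a b d [ra [Ia Ea]] [rd [Id Ed]] Hb.
    destruct (Rle_lt_or_eq_dec a b) as [H1| ->]; [lra| |now exists ra].
    destruct (Rle_lt_or_eq_dec b d) as [H2| <-]; [lra| |now exists rd].
    apply (ivt_on I L ra rd b HI Ia Id); try lra.
    intros s Is. apply (der_continuous_within I L s _ Is (HL s Is)).
  - destruct (proj2 HI) as [a [b [Ia [Ib Hab]]]]. exists (L a), (L b).
    split; [now exists a|]. split; [now exists b|]. auto. }
assert (HS : smooth J sigma).
{ intros k. induction k as [|k IH].
  - intros t Jt. exact (der_continuous_within J sigma t _ Jt (HD t Jt)).
  - exists (fun t => / Cmod (vel I c (sigma t))). split; [exact HD|].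
    apply (class_comp k I J (fun s => / Cmod (vel I c s)) sigma); auto.
    intros t Jt. apply Hsig, Jt. }
assert (ED : forall t, J t -> deriv J sigma t = / Cmod (vel I c (sigma t))).
{ intros t Jt. apply deriv_eq; auto. }
assert (P : forall t, J t -> 0 < / Cmod (vel I c (sigma t))).
{ intros t Jt. apply Rinv_0_lt_compat, Hp, Hsig, Jt. }
exists J, sigma. split.
- split; [exact HJ|]. split; [exact HS|]. split; [intros t Jt; apply Hsig, Jt|]. split.
  + intros s Is. exists (L s). assert (JL : J (L s)) by now exists s.
    split; [exact JL|]. destruct (Hsig _ JL) as [Is' E].
    destruct (Rtotal_order (sigma (L s)) s) as [H|[H|H]]; trivial; exfalso.
    * assert (H' := Linc _ _ Is' Is H). lra.
    * assert (H' := Linc _ _ Is Is' H). lra.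
  + intros t Jt. rewrite ED by exact Jt. specialize (P t Jt). lra.
- intros t Jt. rewrite Cmod_mult, Cmod_R, ED by exact Jt. specialize (P t Jt).
  rewrite Rabs_right by lra. apply Rinv_l. destruct (Hsig t Jt) as [Is _].
  specialize (Hp _ Is). lra.
Qed.

Lemma trivial_reparametrization (I : R -> Prop) : interval I ->
  reparametrization I I (fun s => s).
Proof.
intros HI. assert (H1 : forall s, I s -> der I (fun r => r) s 1).
{ intros s Is. apply der_of_is_derive; [exact Is|]. apply (@is_derive_id R_AbsRing). }
split; [exact HI|]. split.
- apply (smooth_of_der I _ (fun _ => 1) H1). intros k. apply class_const.
- split; [auto|]. split; [intros s Is; now exists s|].
  intros t It. rewrite (deriv_eq I _ t 1 HI It (H1 t It)). lra.
Qed.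

(** * The Darboux relation in the frame of an edge *)

Definition dot2 (a b : C) : R := Re a * Re b + Im a * Im b.

Ltac coords := unfold dot2, det2, Re, Im, RtoC in *; simpl in *.

Lemma C_eq (a b : C) : Re a = Re b -> Im a = Im b -> a = b.
Proof. apply injective_projections. Qed.

Lemma Cmod_sqr (a : C) : Cmod a ^ 2 = dot2 a a.
Proof.
unfold Cmod. rewrite pow2_sqrt; [unfold dot2, Re, Im; ring|].
assert (H1 := pow2_ge_0 (fst a)). assert (H2 := pow2_ge_0 (snd a)). lra.
Qed.

Lemma dot2_pos (a : C) : a <> RtoC 0 -> 0 < dot2 a a.
Proof.
intros H. rewrite <- Cmod_sqr. apply pow_lt. now apply Cmod_gt_0.
Qed.

Lemma lagrange (a b : C) :
  dot2 a a * dot2 b b = dot2 a b ^ 2 + det2 a b ^ 2.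
Proof. unfold dot2, det2. ring. Qed.

(** [dot2 d] and [det2 d] are the coordinates in the orthogonal frame [(d, i d)],
    multiplied by [|d|^2]. *)
Lemma dot2_det2_inj (d u v : C) : d <> RtoC 0 ->
  dot2 d u = dot2 d v -> det2 d u = det2 d v -> u = v.
Proof.
intros Hd H1 H2. apply dot2_pos in Hd.
assert (E : forall z, Re z = (dot2 d z * Re d - det2 d z * Im d) / dot2 d d /\
                      Im z = (dot2 d z * Im d + det2 d z * Re d) / dot2 d d).
{ intros z. unfold dot2, det2 in *. split; field; lra. }
destruct (E u) as [U1 U2]. destruct (E v) as [V1 V2].
apply C_eq; [rewrite U1, V1|rewrite U2, V2]; now rewrite H1, H2.
Qed.

(** Multiplying the relation by the square of the conjugate of [d] gives the first
    two equations as real and imaginary parts; the third is its squared modulus. *)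
Lemma product_in_edge_frame (u v d : C) (lambda : R) :
  (u * v)%C = (RtoC lambda * d ^ 2)%C ->
  dot2 d u * dot2 d v - det2 d u * det2 d v = lambda * dot2 d d ^ 2 /\
  dot2 d u * det2 d v + det2 d u * dot2 d v = 0 /\
  dot2 u u * dot2 v v = lambda ^ 2 * dot2 d d ^ 2.
Proof.
intros H.
assert (H1 := f_equal Re H). assert (H2 := f_equal Im H).
destruct u as [u1 u2], v as [v1 v2], d as [d1 d2]. coords.
assert (E1 : u1 * v1 - u2 * v2 = lambda * (d1 * d1 - d2 * d2)) by (rewrite H1; ring).
assert (E2 : u1 * v2 + u2 * v1 = lambda * (2 * (d1 * d2))) by (rewrite H2; ring).
clear H H1 H2. split; [|split].
- transitivity ((u1 * v1 - u2 * v2) * (d1 * d1 - d2 * d2)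
    + (u1 * v2 + u2 * v1) * (2 * (d1 * d2))); [ring|]. rewrite E1, E2. ring.
- transitivity ((u1 * v2 + u2 * v1) * (d1 * d1 - d2 * d2)
    - (u1 * v1 - u2 * v2) * (2 * (d1 * d2))); [ring|]. rewrite E1, E2. ring.
- transitivity ((u1 * v1 - u2 * v2) ^ 2 + (u1 * v2 + u2 * v1) ^ 2); [ring|].
  rewrite E1, E2. ring.
Qed.

(** With [dot2 d u = dot2 d v], which holds when the length of the edge is
    constant, the imaginary part of the relation factors as
    [dot2 d u * (det2 d u + det2 d v) = 0].  If the second factor vanishes, [v] is
    the reflection of [u] in the line of [d]. *)
Lemma edge_dichotomy (u v d : C) (lambda : R) : d <> RtoC 0 ->
  (u * v)%C = (RtoC lambda * d ^ 2)%C -> dot2 d u = dot2 d v ->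
  dot2 d u = 0 \/ (0 <= lambda /\ det2 d v = - det2 d u /\ dot2 u u = dot2 v v).
Proof.
intros Hd H E. apply dot2_pos in Hd.
apply product_in_edge_frame in H as [H1 [H2 _]]. rewrite <- E in H1, H2.
assert (L1 := lagrange d u). assert (L2 := lagrange d v). rewrite <- E in L2.
destruct (Req_dec (dot2 d u) 0) as [Z|Z]; [now left|right].
assert (B : det2 d v = - det2 d u).
{ apply (Rmult_eq_reg_l (dot2 d u)); lra. }
rewrite B in *. split; [|split; [reflexivity|]].
- apply Rnot_lt_le. intros Hl. assert (0 < dot2 d d ^ 2) by nra. nra.
- apply (Rmult_eq_reg_l (dot2 d d)); [|lra]. rewrite L1, L2. ring.
Qed.

Lemma perpendicular (d z : C) : d <> RtoC 0 -> dot2 d z = 0 ->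
  exists k, z = (RtoC k * (Ci * d))%C.
Proof.
intros Hd H. exists (det2 d z / dot2 d d). apply (dot2_det2_inj d _ _ Hd).
- rewrite H. unfold dot2. simpl. unfold Re, Im. ring.
- apply dot2_pos in Hd. coords. field. lra.
Qed.

Lemma darboux_pair_iff (I : R -> Prop) (m : R -> R) (mu : R) (x y : R -> C) :
  darboux_pair I m mu x y <-> forall s, I s -> (y s - x s)%C <> RtoC 0 /\
    (vel I x s * vel I y s)%C = (RtoC (mu / m s) * (y s - x s) ^ 2)%C.
Proof.
split; intros H s Is; destruct (H s Is) as [Hn E]; clear H.
- assert (Hd : (x s - y s)%C <> RtoC 0) by (intros Z; apply Hn; now apply Ceq_minus).
  split.
  + intros Z. apply Hn. symmetry. now apply Ceq_minus.
  + rewrite <- E. field. exact Hd.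
- assert (Hd : (x s - y s)%C <> RtoC 0).
  { intros Z. apply Hn. apply Ceq_minus in Z. rewrite Z. ring. }
  split.
  + intros Z. apply Hd. rewrite Z. ring.
  + rewrite E. field. exact Hd.
Qed.

(** * Scalar product and determinant along curves *)

Lemma curve_der_minus (I : R -> Prop) (a b : R -> C) (s : R) (u v : C) : I s ->
  curve_der I a s u -> curve_der I b s v ->
  curve_der I (fun r => (a r - b r)%C) s (u - v)%C.
Proof.
intros Is Ha Hb. apply curve_der_iff in Ha as [A1 A2]; [|exact Is].
apply curve_der_iff in Hb as [B1 B2]; [|exact Is].
apply curve_der_iff; [exact Is|]. split.
- exact (der_minus I _ _ s _ _ Is A1 B1).
- exact (der_minus I _ _ s _ _ Is A2 B2).
Qed.

Lemma der_dot2 (I : R -> Prop) (a b : R -> C) (s : R) (u v : C) : I s ->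
  curve_der I a s u -> curve_der I b s v ->
  der I (fun r => dot2 (a r) (b r)) s (dot2 u (b s) + dot2 (a s) v).
Proof.
intros Is Ha Hb. apply curve_der_iff in Ha as [A1 A2]; [|exact Is].
apply curve_der_iff in Hb as [B1 B2]; [|exact Is].
eapply der_eq.
- exact (der_plus I _ _ s _ _ Is (der_mult I _ _ s _ _ Is A1 B1)
           (der_mult I _ _ s _ _ Is A2 B2)).
- unfold dot2. ring.
Qed.

Lemma der_det2 (I : R -> Prop) (a b : R -> C) (s : R) (u v : C) : I s ->
  curve_der I a s u -> curve_der I b s v ->
  der I (fun r => det2 (a r) (b r)) s (det2 u (b s) + det2 (a s) v).
Proof.
intros Is Ha Hb. apply curve_der_iff in Ha as [A1 A2]; [|exact Is].
apply curve_der_iff in Hb as [B1 B2]; [|exact Is].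
eapply der_eq.
- exact (der_minus I _ _ s _ _ Is (der_mult I _ _ s _ _ Is A1 B2)
           (der_mult I _ _ s _ _ Is A2 B1)).
- unfold det2. ring.
Qed.

Definition curve_continuous (I : R -> Prop) (a : R -> C) (s : R) : Prop :=
  continuous_within I (fun r => Re (a r)) s /\ continuous_within I (fun r => Im (a r)) s.

Lemma curve_continuous_smooth (I : R -> Prop) (c : R -> C) (s : R) :
  smooth_curve I c -> I s -> curve_continuous I c s.
Proof.
intros H Is. apply smooth_curve_iff in H as [H1 H2].
split; [exact (H1 0%nat s Is)|exact (H2 0%nat s Is)].
Qed.

Lemma curve_continuous_minus (I : R -> Prop) (a b : R -> C) (s : R) :
  curve_continuous I a s -> curve_continuous I b s -> curve_continuous I (fun r => (a r - b r)%C) s.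
Proof.
intros [A1 A2] [B1 B2]. split.
- exact (continuous_within_minus I _ _ s A1 B1).
- exact (continuous_within_minus I _ _ s A2 B2).
Qed.

Lemma curve_continuous_mult (I : R -> Prop) (a b : R -> C) (s : R) :
  curve_continuous I a s -> curve_continuous I b s -> curve_continuous I (fun r => (a r * b r)%C) s.
Proof.
intros [A1 A2] [B1 B2]. split.
- exact (continuous_within_minus I _ _ s (continuous_within_mult I _ _ s A1 B1) (continuous_within_mult I _ _ s A2 B2)).
- exact (continuous_within_plus I _ _ s (continuous_within_mult I _ _ s A1 B2) (continuous_within_mult I _ _ s A2 B1)).
Qed.

Lemma continuous_within_dot2 (I : R -> Prop) (a b : R -> C) (s : R) :
  curve_continuous I a s -> curve_continuous I b s -> continuous_within I (fun r => dot2 (a r) (b r)) s.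
Proof.
intros [A1 A2] [B1 B2].
exact (continuous_within_plus I _ _ s (continuous_within_mult I _ _ s A1 B1) (continuous_within_mult I _ _ s A2 B2)).
Qed.

Lemma continuous_within_det2 (I : R -> Prop) (a b : R -> C) (s : R) :
  curve_continuous I a s -> curve_continuous I b s -> continuous_within I (fun r => det2 (a r) (b r)) s.
Proof.
intros [A1 A2] [B1 B2].
exact (continuous_within_minus I _ _ s (continuous_within_mult I _ _ s A1 B2) (continuous_within_mult I _ _ s A2 B1)).
Qed.

(** * Edges of arc-length preserving Darboux transformations *)

Lemma rigid_edge (I : R -> Prop) (x y : R -> C) (D : R) : interval I ->
  smooth_curve I x -> smooth_curve I y ->
  (forall s, I s -> dot2 (y s - x s)%C (y s - x s)%C = D) ->
  forall s, I s ->
    dot2 (y s - x s)%C (vel I x s) = dot2 (y s - x s)%C (vel I y s).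
Proof.
intros HI Hx Hy HD s Is.
assert (Hd := curve_der_minus I y x s _ _ Is (smooth_curve_der I y s HI Hy Is)
  (smooth_curve_der I x s HI Hx Is)).
assert (H1 := der_dot2 I _ _ s _ _ Is Hd Hd).
assert (H2 := der_ext I _ _ s 0 Is (fun r Ir => eq_sym (HD r Ir)) (der_const I D s Is)).
assert (E := der_unique I _ s _ _ HI Is H1 H2).
unfold dot2 in *. simpl in *. unfold Re, Im in *. simpl in *. lra.
Qed.

Lemma polarization_sqr (I : R -> Prop) (m : R -> R) (x : R -> C) (s : R) : I s ->
  arc_length_polarization I m x -> m s <> 0 ->
  0 < m s /\ dot2 (vel I x s) (vel I x s) = / m s.
Proof.
intros Is H Hm. specialize (H s Is). rewrite Cmod_sqr in H.
unfold Rdiv in H. rewrite Rmult_1_l in H. split; [|now symmetry].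
assert (0 <= / m s) by (rewrite H; unfold dot2; nra).
assert (/ m s <> 0) by now apply Rinv_neq_0_compat.
rewrite <- (Rinv_inv (m s)). apply Rinv_0_lt_compat. lra.
Qed.

Lemma darboux_edge_length (I : R -> Prop) (m : R -> R) (mu : R) (x y : R -> C) :
  (forall s, I s -> m s <> 0) -> mu <> 0 -> darboux_pair I m mu x y ->
  arc_length_polarization I m x -> arc_length_polarization I m y ->
  forall s, I s -> dot2 (y s - x s)%C (y s - x s)%C = / Rabs mu.
Proof.
intros Hm Hmu Hd Hx Hy s Is.
destruct (polarization_sqr I m x s Is Hx (Hm s Is)) as [M Ex].
destruct (polarization_sqr I m y s Is Hy (Hm s Is)) as [_ Ey].
destruct (proj1 (darboux_pair_iff _ _ _ _ _) Hd s Is) as [Hn E].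
apply product_in_edge_frame in E as [_ [_ E]]. rewrite Ex, Ey in E.
apply dot2_pos in Hn. set (D := dot2 (y s - x s)%C (y s - x s)%C) in *.
assert (E' : (Rabs mu * D) ^ 2 = 1).
{ rewrite Rpow_mult_distr, pow2_abs.
  transitivity ((mu / m s) ^ 2 * D ^ 2 * (m s) ^ 2); [field; lra|].
  rewrite <- E. field. lra. }
assert (P := Rabs_pos_lt mu Hmu).
assert (E2 : Rabs mu * D = 1) by (assert (0 < Rabs mu * D) by nra; nra).
rewrite <- (Rmult_1_r (/ Rabs mu)), <- E2. field. lra.
Qed.

(** For [mu < 0] only the alternative of [edge_dichotomy] with velocities orthogonal
    to the edge is left; equal speeds and the sign of [mu] then make them equal. *)
Lemma trivial_of_negative (I : R -> Prop) (m : R -> R) (mu : R) (x y : R -> C) :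
  interval I -> smooth_curve I x -> smooth_curve I y ->
  (forall s, I s -> m s <> 0) -> mu < 0 -> darboux_pair I m mu x y ->
  arc_length_polarization I m x -> arc_length_polarization I m y ->
  forall s, I s -> vel I y s = vel I x s /\ det2 (vel I x s) (y s - x s)%C <> 0.
Proof.
intros HI Sx Sy Hm Hmu Hd Hx Hy s Is.
assert (R := rigid_edge I x y _ HI Sx Sy
  (darboux_edge_length I m mu x y Hm (Rlt_not_eq _ _ Hmu) Hd Hx Hy) s Is).
destruct (polarization_sqr I m x s Is Hx (Hm s Is)) as [M Ex].
destruct (polarization_sqr I m y s Is Hy (Hm s Is)) as [_ Ey].
destruct (proj1 (darboux_pair_iff _ _ _ _ _) Hd s Is) as [Hn E].
assert (Hl : mu / m s < 0).
{ apply Rmult_neg_pos; [exact Hmu|now apply Rinv_0_lt_compat]. }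
destruct (edge_dichotomy _ _ _ _ Hn E R) as [Z|[Hc _]]; [|lra].
apply product_in_edge_frame in E as [E _]. rewrite <- R, Z in E.
assert (Lx := lagrange (y s - x s)%C (vel I x s)).
assert (Ly := lagrange (y s - x s)%C (vel I y s)).
rewrite <- R, Z, Ey in Ly. rewrite Z, Ex in Lx.
assert (Hp := dot2_pos _ Hn).
set (D := dot2 (y s - x s)%C (y s - x s)%C) in *.
set (b := det2 (y s - x s)%C (vel I x s)) in *.
set (b' := det2 (y s - x s)%C (vel I y s)) in *.
assert (P : 0 < b * b') by (assert (0 < D ^ 2) by nra; nra).
assert (B : b = b').
{ apply Rminus_diag_uniq. assert (Q : (b - b') * (b + b') = 0) by nra.
  apply Rmult_integral in Q as [Q|Q]; [exact Q|]. exfalso. nra. }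
split.
- symmetry. now apply (dot2_det2_inj _ _ _ Hn).
- intros K. assert (b = 0). { unfold b. clear - K. unfold det2 in *. lra. } nra.
Qed.

(** * Three consecutive vertices *)

(** Both polarizations at once: the Darboux relation of (i) and (ii), cleared of its
    denominator, together with the normalization that [mu] is the discrete
    arc-length polarization of the edge. *)
Definition darboux_edge (I : R -> Prop) (m : R -> R) (mu : R) (x y : R -> C) : Prop :=
  forall s, I s ->
    (y s - x s)%C <> RtoC 0 /\
    (vel I x s * vel I y s)%C = (RtoC (mu / m s) * (y s - x s) ^ 2)%C /\
    mu * dot2 (y s - x s)%C (y s - x s)%C = 1.

Lemma darboux_edge_speeds (I : R -> Prop) (m : R -> R) (mu : R) (x y : R -> C) (s : R) :
  I s -> m s <> 0 -> darboux_edge I m mu x y ->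
  dot2 (vel I x s) (vel I x s) * dot2 (vel I y s) (vel I y s) = (/ m s) ^ 2.
Proof.
intros Is Hm H. destruct (H s Is) as [Hn [E N]].
apply product_in_edge_frame in E as [_ [_ E]]. rewrite E.
transitivity ((mu * dot2 (y s - x s)%C (y s - x s)%C) ^ 2 * (/ m s) ^ 2).
- field. exact Hm.
- rewrite N. ring.
Qed.

Lemma darboux_edge_rigid (I : R -> Prop) (m : R -> R) (mu : R) (x y : R -> C) (s : R) :
  interval I -> smooth_curve I x -> smooth_curve I y ->
  I s -> darboux_edge I m mu x y ->
  dot2 (y s - x s)%C (vel I x s) = dot2 (y s - x s)%C (vel I y s).
Proof.
intros HI Sx Sy Is H. apply (rigid_edge I x y (/ mu) HI Sx Sy); [|exact Is].
intros r Ir. destruct (H r Ir) as [_ [_ N]].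
assert (mu <> 0) by (intros Z; rewrite Z, Rmult_0_l in N; lra).
apply (Rmult_eq_reg_l mu); [|assumption]. rewrite N. now field.
Qed.

(** The instantaneous consequence of collinearity.  Here [d] and [e] are two
    consecutive edges and [p], [q], [r] the velocities of their vertices.
    Orthogonality gives [e = t d] and [p = l i d], [q = k i d], [r = n i d]; the two
    Darboux relations give [l k = n k = - mu / m], hence [n = l], and the derivative
    of the determinant of the edges is a multiple of [(k - l) (t + 1)].  As [l k] is
    negative, [k <> l] and so [t = - 1]. *)
Lemma fold_of_collinear (d e p q r : C) (mu nu m : R) : d <> RtoC 0 -> e <> RtoC 0 ->
  0 < m -> mu * dot2 d d = 1 -> nu * dot2 e e = 1 ->
  (p * q)%C = (RtoC (mu / m) * d ^ 2)%C ->
  (q * r)%C = (RtoC (nu / m) * e ^ 2)%C ->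
  dot2 d p = 0 -> dot2 d q = 0 -> dot2 e q = 0 -> dot2 e r = 0 ->
  det2 (q - p)%C e + det2 d (r - q)%C = 0 ->
  (d + e)%C = RtoC 0 /\ mu = nu.
Proof.
intros Hd He Hm Nd Ne E1 E2 Dp Dq Eq Er F.
assert (Pd := dot2_pos d Hd). assert (Pe := dot2_pos e He).
destruct (perpendicular d q Hd Dq) as [k Ek].
destruct (perpendicular d p Hd Dp) as [l El].
assert (Hmu : 0 < mu / m).
{ apply Rdiv_lt_0_compat; [|exact Hm]. apply Rnot_le_lt. intros Hle. nra. }
apply product_in_edge_frame in E1 as [E1 [_ _]].
apply product_in_edge_frame in E2 as [E2 [_ _]].
assert (Hkl : l * k = - (mu / m)).
{ rewrite Dp, Dq, El, Ek in E1.
  replace (det2 d (RtoC l * (Ci * d))%C) with (l * dot2 d d) in E1 by (coords; ring).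
  replace (det2 d (RtoC k * (Ci * d))%C) with (k * dot2 d d) in E1 by (coords; ring).
  assert (Z : (l * k + mu / m) * dot2 d d ^ 2 = 0) by lra.
  apply Rmult_integral in Z as [Z|Z]; [lra|nra]. }
assert (Hk : k <> 0) by (intros ->; lra).
(* both [d] and [e] are orthogonal to [q <> 0] *)
set (t := dot2 d e / dot2 d d).
assert (Et : e = (RtoC t * d)%C).
{ apply (dot2_det2_inj d _ _ Hd).
  - unfold t. coords. field. lra.
  - apply (Rmult_eq_reg_l k); [|exact Hk]. rewrite Ek in Eq. coords. lra. }
assert (Ht : t <> 0).
{ intros Z. apply He. rewrite Et, Z. ring. }
assert (Dr : dot2 d r = 0).
{ apply (Rmult_eq_reg_l t); [|exact Ht]. rewrite Et in Er. clearbody t. coords. lra. }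
destruct (perpendicular d r Hd Dr) as [n En].
assert (Hn : nu * t ^ 2 = mu).
{ apply (Rmult_eq_reg_r (dot2 d d)); [|lra]. rewrite Nd, <- Ne, Et.
  clearbody t. coords. ring. }
assert (Hkn : n * k = - (mu / m)).
{ rewrite Eq, Er, En, Ek, Et in E2.
  replace (det2 (RtoC t * d)%C (RtoC n * (Ci * d))%C) with (t * n * dot2 d d) in E2
    by (clearbody t; coords; ring).
  replace (det2 (RtoC t * d)%C (RtoC k * (Ci * d))%C) with (t * k * dot2 d d) in E2
    by (clearbody t; coords; ring).
  replace (dot2 (RtoC t * d)%C (RtoC t * d)%C) with (t ^ 2 * dot2 d d) in E2
    by (clearbody t; coords; ring).
  assert (Z : (n * k + mu / m) * (t ^ 2 * dot2 d d ^ 2) = 0).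
  { rewrite <- Hn.
    transitivity (t ^ 2 * dot2 d d ^ 2 * (n * k) + nu / m * (t ^ 2 * dot2 d d) ^ 2);
      [field; lra|]. lra. }
  apply Rmult_integral in Z as [Z|Z]; [lra|].
  assert (0 < t ^ 2 * dot2 d d ^ 2)
    by (apply Rmult_lt_0_compat; [now apply pow2_gt_0|now apply pow_lt]). lra. }
assert (Hnl : n = l) by (apply (Rmult_eq_reg_r k); [lra|exact Hk]).
assert (Hkl' : k - l <> 0) by (intros Z; replace k with l in Hkl by lra; assert (Q := pow2_ge_0 l); simpl in Q; lra).
assert (T : t = - 1).
{ assert (Z : (k - l) * (- (t + 1) * dot2 d d) = 0).
  { rewrite <- F, Ek, El, En, Et, Hnl. clearbody t. coords. ring. }
  apply Rmult_integral in Z as [Z|Z]; [contradiction|].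
  apply Rmult_integral in Z as [Z|Z]; lra. }
split.
- rewrite Et, T. apply C_eq; coords; ring.
- rewrite <- Hn, T. ring.
Qed.

(** Subtracting the two Darboux relations, which have the same coefficient, gives
    [(r - p) q = lambda (e - d) (e + d)]; eliminating [lambda] and cancelling [q]
    leaves [(r - p) d^2 = p (e - d) (d + e)].  For two consecutive edges [d], [e] and
    the velocities [p], [q], [r] of their vertices, [r - p] is the derivative of
    [d + e].  The stated identity is the part of
    this that governs the squared length of [d + e]. *)
Lemma fold_ode (d e p q r : C) (lambda : R) : q <> RtoC 0 ->
  (p * q)%C = (RtoC lambda * d ^ 2)%C -> (q * r)%C = (RtoC lambda * e ^ 2)%C ->
  dot2 (d + e)%C (r - p)%C * dot2 d d ^ 2 =
  dot2 (d + e)%C (d + e)%C * dot2 (p * (e - d))%C (d * d)%C.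
Proof.
intros Hq E1 E2.
assert (E : ((r - p) * d ^ 2)%C = (p * (e - d) * (d + e))%C).
{ assert (Z : (q * ((r - p) * d ^ 2 - p * (e - d) * (d + e)))%C = RtoC 0).
  { transitivity ((q * r) * d ^ 2 - (p * q) * e ^ 2)%C; [ring|]. rewrite E1, E2. ring. }
  apply Ceq_minus. apply NNPP. intros K. now apply (Cmult_neq_0 _ _ Hq K). }
transitivity (dot2 ((r - p) * d ^ 2)%C ((d * d) * (d + e))%C).
- coords. ring.
- rewrite E. coords. ring.
Qed.

(** By [fold_ode] the squared distance of the outer vertices satisfies a linear
    homogeneous differential equation, so it vanishes everywhere or nowhere. *)
Lemma fold_persists (I : R -> Prop) (m : R -> R) (mu : R) (p q r : R -> C) (s s0 : R) :
  interval I -> smooth_curve I p -> smooth_curve I q -> smooth_curve I r ->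
  (forall t, I t -> m t <> 0) -> darboux_edge I m mu p q -> darboux_edge I m mu q r ->
  I s -> I s0 -> r s = p s -> r s0 = p s0.
Proof.
intros HI Sp Sq Sr Hm Hpq Hqr Is I0 E.
assert (Hmu : mu <> 0).
{ intros Z. destruct (Hpq s Is) as [_ [_ N]]. rewrite Z in N. lra. }
set (d := fun t => (q t - p t)%C). set (e := fun t => (r t - q t)%C).
set (g := fun t => dot2 (r t - p t)%C (r t - p t)%C).
assert (G : g s0 = 0).
{ apply (zero_of_linear_ode I g (fun t => 2 * mu ^ 2 *
    dot2 (vel I p t * (e t - d t))%C (d t * d t)%C) s HI Is); trivial.
  - intros t It.
    assert (Cd : curve_continuous I d t) by (apply curve_continuous_minus; now apply curve_continuous_smooth).
    assert (Ce : curve_continuous I e t) by (apply curve_continuous_minus; now apply curve_continuous_smooth).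
    assert (Cp : curve_continuous I (vel I p) t) by now apply curve_continuous_smooth, It; apply smooth_vel.
    apply continuous_within_mult; [apply continuous_within_const|].
    apply (continuous_within_dot2 I (fun r => (vel I p r * (e r - d r))%C) (fun r => (d r * d r)%C)).
    + apply (curve_continuous_mult I (vel I p) (fun r => (e r - d r)%C)); [exact Cp|now apply curve_continuous_minus].
    + now apply curve_continuous_mult.
  - intros t It. unfold g.
    assert (Dm := curve_der_minus I r p t _ _ It (smooth_curve_der I r t HI Sr It)
      (smooth_curve_der I p t HI Sp It)).
    eapply der_eq; [exact (der_dot2 I _ _ t _ _ It Dm Dm)|].
    destruct (Hpq t It) as [Hd [E1 N]]. destruct (Hqr t It) as [He [E2 _]].
    assert (Hq : vel I q t <> RtoC 0).
    { intros Z. rewrite Z in E2.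
      assert (K := product_in_edge_frame _ _ _ _ E2). destruct K as [_ [_ K]].
      apply dot2_pos in He. assert (mu / m t <> 0).
      { apply Rmult_integral_contrapositive_currified; trivial.
        apply Rinv_neq_0_compat; auto. }
      assert (0 < (mu / m t) ^ 2) by now apply pow2_gt_0.
      assert (0 < dot2 (r t - q t)%C (r t - q t)%C ^ 2) by nra.
      unfold dot2 at 1 in K. simpl Re in K. simpl Im in K. nra. }
    assert (O := fold_ode _ _ _ _ _ _ Hq E1 E2).
    fold (d t) in O, N. fold (e t) in O.
    replace (d t + e t)%C with (r t - p t)%C in O by (unfold d, e; ring).
    transitivity (2 * (mu * dot2 (d t) (d t)) ^ 2 *
      dot2 (r t - p t)%C (vel I r t - vel I p t)%C).
    { rewrite N. unfold dot2. ring. }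
    transitivity (2 * mu ^ 2 * (dot2 (r t - p t)%C (vel I r t - vel I p t)%C
      * dot2 (d t) (d t) ^ 2)); [ring|]. rewrite O. ring.
  - unfold g. rewrite E. unfold dot2. simpl. unfold Re, Im. simpl. ring. }
apply Ceq_minus. apply NNPP. intros K. apply dot2_pos in K. unfold g in G. lra.
Qed.

(** For negative [m] both edges would be orthogonal to the nonzero velocity of the
    middle vertex, hence parallel. *)
Lemma positive_parameter_at (I : R -> Prop) (m : R -> R) (mu nu : R) (p q r : R -> C) (s : R) :
  interval I -> smooth_curve I p -> smooth_curve I q -> smooth_curve I r ->
  I s -> m s <> 0 -> darboux_edge I m mu p q -> darboux_edge I m nu q r ->
  det2 (q s - p s)%C (r s - q s)%C <> 0 -> 0 < m s.
Proof.
intros HI Sp Sq Sr Is Hm Hpq Hqr Hdet. apply Rnot_le_lt. intros Hle.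
assert (Neg : forall x y k, darboux_edge I m k x y -> smooth_curve I x ->
  smooth_curve I y -> dot2 (y s - x s)%C (vel I x s) = 0).
{ intros x y k H Sx Sy.
  assert (R := darboux_edge_rigid I m k x y s HI Sx Sy Is H).
  destruct (H s Is) as [Hn [E N]].
  destruct (edge_dichotomy _ _ _ _ Hn E R) as [Z|[Hc _]]; [exact Z|].
  apply dot2_pos in Hn.
  assert (0 < k) by (apply Rnot_le_lt; intros Hk; nra).
  assert (k / m s < 0) by (apply Rmult_pos_neg; [assumption|apply Rinv_lt_0_compat; lra]).
  lra. }
assert (Z1 := Neg p q mu Hpq Sp Sq).
rewrite (darboux_edge_rigid I m mu p q s HI Sp Sq Is Hpq) in Z1.
assert (Z2 := Neg q r nu Hqr Sq Sr).
assert (Sp2 := darboux_edge_speeds I m mu p q s Is Hm Hpq).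
assert (Hq : vel I q s <> RtoC 0).
{ intros Z. rewrite Z in Sp2.
  replace (dot2 (RtoC 0) (RtoC 0)) with 0 in Sp2 by (coords; ring).
  assert (/ m s <> 0) by now apply Rinv_neq_0_compat. nra. }
apply Hdet. apply dot2_pos in Hq.
apply (Rmult_eq_reg_l (dot2 (vel I q s) (vel I q s))); [|lra]. rewrite Rmult_0_r.
set (v := vel I q s) in *. set (d := (q s - p s)%C) in *. set (e := (r s - q s)%C) in *.
transitivity (dot2 d v * det2 v e - dot2 e v * det2 v d); [unfold dot2, det2; ring|].
rewrite Z1, Z2. ring.
Qed.

(** Equality of the speeds is proved at the middle vertex; the products of speeds
    along the two edges then give it at the outer ones. *)
Lemma arc_length_of_triple (I : R -> Prop) (m : R -> R) (mu nu : R) (p q r : R -> C) (s0 : R) :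
  interval I -> smooth_curve I p -> smooth_curve I q -> smooth_curve I r ->
  (forall t, I t -> m t <> 0) -> darboux_edge I m mu p q -> darboux_edge I m nu q r ->
  I s0 -> det2 (q s0 - p s0)%C (r s0 - q s0)%C <> 0 ->
  forall s, I s ->
    dot2 (vel I p s) (vel I p s) = / m s /\ dot2 (vel I q s) (vel I q s) = / m s /\
    dot2 (vel I r s) (vel I r s) = / m s.
Proof.
intros HI Sp Sq Sr Hm Hpq Hqr I0 Hdet.
assert (Cd : forall t, I t -> curve_continuous I (fun t => (q t - p t)%C) t).
{ intros t It. apply curve_continuous_minus; now apply curve_continuous_smooth. }
assert (Vp : forall t, I t -> curve_continuous I (vel I p) t).
{ intros t It. now apply curve_continuous_smooth, It; apply smooth_vel. }
assert (Vq : forall t, I t -> curve_continuous I (vel I q) t).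
{ intros t It. now apply curve_continuous_smooth, It; apply smooth_vel. }
assert (M : forall s, I s -> 0 < m s).
{ (* [f] is the real part of [p' q'] times the squared conjugate of the edge, a
     continuous multiple of [1 / m] *)
  set (f := fun t => dot2 (q t - p t)%C (vel I p t) * dot2 (q t - p t)%C (vel I q t) -
                     det2 (q t - p t)%C (vel I p t) * det2 (q t - p t)%C (vel I q t)).
  assert (F : forall t, I t -> mu * (f t) = / m t).
  { intros t It. destruct (Hpq t It) as [_ [E N]].
    apply product_in_edge_frame in E as [E _]. unfold f. rewrite E.
    transitivity (/ m t * (mu * dot2 (q t - p t)%C (q t - p t)%C) ^ 2); [field; auto|].
    rewrite N. ring. }
  assert (M0 := positive_parameter_at I m mu nu p q r s0 HI Sp Sq Sr I0 (Hm s0 I0) Hpq Hqr Hdet).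
  intros s Is. rewrite <- (Rinv_inv (m s)). apply Rinv_0_lt_compat. rewrite <- F by exact Is.
  apply (pos_of_nonzero_on I (fun t => mu * f t) s0 HI I0); trivial.
  - intros t It. apply continuous_within_mult; [apply continuous_within_const|]. unfold f.
    exact (continuous_within_minus I _ _ t
      (continuous_within_mult I _ _ t (continuous_within_dot2 I _ _ t (Cd t It) (Vp t It))
                           (continuous_within_dot2 I _ _ t (Cd t It) (Vq t It)))
      (continuous_within_mult I _ _ t (continuous_within_det2 I _ _ t (Cd t It) (Vp t It))
                           (continuous_within_det2 I _ _ t (Cd t It) (Vq t It)))).
  - intros t It. rewrite F by exact It. apply Rinv_neq_0_compat; auto.
  - rewrite F by exact I0. now apply Rinv_0_lt_compat. }
intros s Is.
assert (S1 := darboux_edge_speeds I m mu p q s Is (Hm s Is) Hpq).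
assert (S2 := darboux_edge_speeds I m nu q r s Is (Hm s Is) Hqr).
assert (Ms := Rinv_0_lt_compat _ (M s Is)).
assert (Q : dot2 (vel I q s) (vel I q s) = / m s).
2:{ rewrite Q in *. split; [nra|]. split; [reflexivity|nra]. }
(* if not, the speeds along each of the two edges differ, also near [s] *)
apply NNPP. intros Hne.
assert (Hpos : forall z : C, 0 <= dot2 z z) by (intros z; unfold dot2; nra).
assert (Hpq' : dot2 (vel I p s) (vel I p s) - dot2 (vel I q s) (vel I q s) <> 0).
{ intros Z. apply Hne. assert (P := Hpos (vel I q s)). nra. }
assert (Near : exists delta, 0 < delta /\ forall y, I y -> Rabs (y - s) < delta ->
   dot2 (vel I p y) (vel I p y) - dot2 (vel I q y) (vel I q y) <> 0).
{ assert (L : continuous_within I (fun y => dot2 (vel I p y) (vel I p y) - dot2 (vel I q y) (vel I q y)) s)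
    by (apply continuous_within_minus; apply continuous_within_dot2; auto).
  rewrite continuous_within_eps in L. destruct (L _ (Rabs_pos_lt _ Hpq')) as [delta [Hd H]].
  exists delta. split; [exact Hd|]. intros y Iy Hy Z. specialize (H y Iy Hy).
  cbv beta in H. rewrite Z, Rminus_0_l, Rabs_Ropp in H. lra. }
destruct Near as [delta [Hdelta Near]].
assert (Perp : forall y, I y -> Rabs (y - s) < delta ->
  dot2 (q y - p y)%C (vel I p y) = 0 /\ dot2 (r y - q y)%C (vel I q y) = 0).
{ intros y Iy Hy. specialize (Near y Iy Hy). assert (My := Rinv_0_lt_compat _ (M y Iy)).
  assert (T1 := darboux_edge_speeds I m mu p q y Iy (Hm y Iy) Hpq).
  assert (T2 := darboux_edge_speeds I m nu q r y Iy (Hm y Iy) Hqr).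
  split.
  - destruct (Hpq y Iy) as [Hn [E _]].
    destruct (edge_dichotomy _ _ _ _ Hn E (darboux_edge_rigid I m mu p q y HI Sp Sq Iy Hpq))
      as [Z|[_ [_ Z]]]; [exact Z|lra].
  - destruct (Hqr y Iy) as [Hn [E _]].
    destruct (edge_dichotomy _ _ _ _ Hn E (darboux_edge_rigid I m nu q r y HI Sq Sr Iy Hqr))
      as [Z|[_ [_ Z]]]; [exact Z|].
    exfalso. rewrite <- Z in T2. assert (P := Hpos (vel I q y)).
    assert (dot2 (vel I q y) (vel I q y) = / m y) as Q' by nra. rewrite Q' in *. nra. }
assert (Collinear : forall y, I y -> Rabs (y - s) < delta ->
  0 = det2 (q y - p y)%C (r y - q y)%C).
{ intros y Iy Hy. destruct (Perp y Iy Hy) as [Z1 Z2].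
  rewrite (darboux_edge_rigid I m mu p q y HI Sp Sq Iy Hpq) in Z1.
  assert (T1 := darboux_edge_speeds I m mu p q y Iy (Hm y Iy) Hpq).
  assert (My := Rinv_0_lt_compat _ (M y Iy)).
  assert (Pq : 0 < dot2 (vel I q y) (vel I q y)).
  { destruct (Hpos (vel I q y)) as [H|H]; [exact H|]. rewrite <- H in T1. nra. }
  apply (Rmult_eq_reg_l (dot2 (vel I q y) (vel I q y))); [|lra]. rewrite Rmult_0_r.
  set (v := vel I q y) in *. set (d := (q y - p y)%C) in *. set (e := (r y - q y)%C) in *.
  transitivity (dot2 d v * det2 v e - dot2 e v * det2 v d); [|unfold dot2, det2; ring].
  rewrite Z1, Z2. ring. }
assert (Dpq := curve_der_minus I q p s _ _ Is (smooth_curve_der I q s HI Sq Is)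
  (smooth_curve_der I p s HI Sp Is)).
assert (Dqr := curve_der_minus I r q s _ _ Is (smooth_curve_der I r s HI Sr Is)
  (smooth_curve_der I q s HI Sq Is)).
assert (F := der_unique I _ s _ _ HI Is (der_det2 I _ _ s _ _ Is Dpq Dqr)
  (der_ext_near I _ _ s 0 delta Is Hdelta Collinear (der_const I 0 s Is))).
destruct (Perp s Is) as [Z1 Z2]; [rewrite Rminus_diag, Rabs_R0; exact Hdelta|].
assert (R1 := darboux_edge_rigid I m mu p q s HI Sp Sq Is Hpq).
assert (R2 := darboux_edge_rigid I m nu q r s HI Sq Sr Is Hqr).
destruct (Hpq s Is) as [Hn1 [E1 N1]]. destruct (Hqr s Is) as [Hn2 [E2 N2]].
destruct (fold_of_collinear _ _ _ _ _ _ _ _ Hn1 Hn2 (M s Is) N1 N2 E1 E2) as [Fold Hmu]; trivial.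
{ now rewrite <- R1. }
{ now rewrite <- R2. }
subst nu. apply Hdet.
assert (E : r s0 = p s0).
{ apply (fold_persists I m mu p q r s s0); trivial. apply Ceq_minus. rewrite <- Fold. ring. }
rewrite E. unfold det2. simpl. unfold Re, Im. simpl. ring.
Qed.

(** * Angles and the reflection form of the isoperimetric motion *)

Lemma expi_plus (a b : R) : expi (a + b) = (expi a * expi b)%C.
Proof.
apply C_eq; unfold expi, Re, Im; simpl; [rewrite cos_plus|rewrite sin_plus]; ring.
Qed.

Lemma dot2_expi (a : R) : dot2 (expi a) (expi a) = 1.
Proof.
unfold dot2, expi, Re, Im. simpl. assert (H := sin2_cos2 a). unfold Rsqr in H. lra.
Qed.

Lemma expi_opp (a : R) : (expi (- a) * expi a)%C = RtoC 1.
Proof.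
rewrite <- expi_plus. replace (- a + a) with 0 by ring.
apply C_eq; unfold expi, Re, Im, RtoC; simpl; [apply cos_0|apply sin_0].
Qed.

Lemma expi_period (a : R) (k : Z) : expi (a + 2 * PI * IZR k) = expi a.
Proof.
assert (S : sin (IZR k * PI) = 0) by (apply sin_eq_0_1; now exists k).
rewrite expi_plus.
replace (expi (2 * PI * IZR k)) with (RtoC 1); [ring|].
replace (2 * PI * IZR k) with (2 * (IZR k * PI)) by ring.
apply C_eq; unfold expi, Re, Im, RtoC; simpl.
- rewrite cos_2a_sin, S. ring.
- rewrite sin_2a, S. ring.
Qed.

Lemma unit_angle (z : C) : dot2 z z = 1 -> exists phi, z = expi phi.
Proof.
destruct z as [a b]. unfold dot2, Re, Im. simpl. intros H.
assert (Ha : -1 <= a <= 1) by nra.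
destruct (Rle_dec 0 b) as [Hb|Hb].
- exists (acos a). apply C_eq; unfold expi, Re, Im; simpl.
  + symmetry. now apply cos_acos.
  + rewrite sin_acos by exact Ha. symmetry.
    replace (1 - Rsqr a) with (b * b) by (unfold Rsqr; lra). now apply sqrt_square.
- exists (- acos a). apply C_eq; unfold expi, Re, Im; simpl.
  + rewrite cos_neg. symmetry. now apply cos_acos.
  + rewrite sin_neg, sin_acos by exact Ha.
    replace (1 - Rsqr a) with ((- b) * (- b)) by (unfold Rsqr; lra).
    rewrite sqrt_square by lra. ring.
Qed.

Lemma direction_expi (x : Z -> R -> C) (n : Z) (s w : R) :
  direction x n s w = (expi w * tangent x n s)%C.
Proof.
unfold direction, normal.
replace (expi w) with (RtoC (cos w) + Ci * RtoC (sin w))%C; [ring|].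
apply C_eq; unfold expi, Re, Im, RtoC, Ci; simpl; ring.
Qed.

Lemma edge_length_sqr (x : Z -> R -> C) (n : Z) (s : R) :
  edge_length x n s ^ 2 = dot2 (x (n + 1)%Z s - x n s)%C (x (n + 1)%Z s - x n s)%C.
Proof. apply Cmod_sqr. Qed.

Lemma edge_length_pos (x : Z -> R -> C) (n : Z) (s : R) :
  x n s <> x (n + 1)%Z s -> 0 < edge_length x n s.
Proof.
intros H. apply Cmod_gt_0. intros Z. apply H. symmetry. now apply Ceq_minus.
Qed.

Lemma tangent_sqr (x : Z -> R -> C) (n : Z) (s : R) : x n s <> x (n + 1)%Z s ->
  (RtoC (edge_length x n s ^ 2) * (tangent x n s * tangent x n s))%C =
  ((x (n + 1)%Z s - x n s) ^ 2)%C.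
Proof.
intros H. apply edge_length_pos in H. unfold tangent. rewrite RtoC_pow.
field. intros Z. apply RtoC_inj in Z. lra.
Qed.

Lemma dot2_tangent (x : Z -> R -> C) (n : Z) (s : R) : x n s <> x (n + 1)%Z s ->
  dot2 (tangent x n s) (tangent x n s) = 1.
Proof.
intros H. apply edge_length_pos in H. unfold tangent.
rewrite <- Cmod_sqr, Cmod_div.
- fold (edge_length x n s). rewrite Cmod_R, Rabs_right by lra. field. lra.
- intros Z. apply RtoC_inj in Z. lra.
Qed.

(** The angle condition says that the end point moves in the direction [- w_n] of
    the edge whenever the initial point moves in the direction [w_n]. *)
Lemma isoperimetric_edge (Sigma : Z -> Prop) (J : R -> Prop) (y : Z -> R -> C)
    (n : Z) (t : R) : isoperimetric_motion Sigma J y -> edge Sigma n -> J t ->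
  (vel J (y n) t * vel J (y (n + 1)%Z) t)%C = (tangent y n t * tangent y n t)%C.
Proof.
intros [_ [_ [_ [w [k H]]]]] He Jt.
destruct (H n t He Jt) as [E [Hin Hend]].
assert (V : vel J (y (n + 1)%Z) t = (expi (- w n t) * tangent y n t)%C :> C).
{ destruct (classic (Sigma (n + 2)%Z)) as [Hs|Hs].
  - destruct (Hin Hs) as [T W].
    destruct (H (n + 1)%Z t) as [E' _]; trivial.
    { split; [apply He|]. now replace (n + 1 + 1)%Z with (n + 2)%Z by lia. }
    rewrite E', direction_expi, T, <- W, expi_plus. ring.
  - rewrite (Hend Hs). apply direction_expi. }
rewrite V, E, direction_expi.
transitivity (expi (- w n t) * expi (w n t) * (tangent y n t * tangent y n t))%C; [ring|].
rewrite expi_opp. ring.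
Qed.

Lemma isoperimetric_edge_length (Sigma : Z -> Prop) (J : R -> Prop) (y : Z -> R -> C)
    (n : Z) : interval J -> isoperimetric_motion Sigma J y -> edge Sigma n ->
  exists a, 0 < a /\ forall t, J t -> edge_length y n t = a.
Proof.
intros HJ [_ [_ [H _]]] He.
destruct (interval_inhabited J HJ) as [t0 J0]. exists (edge_length y n t0). split.
- apply edge_length_pos. now apply H.
- intros t Jt. apply (constant_on J); trivial. intros r Jr. now apply H.
Qed.

(** Converse of [isoperimetric_edge]: [w] is chosen on every edge, and the curvature
    at a vertex is defined from the two neighbouring angles by the isoperimetric
    condition.  It is an angle between the tangents because both adjacent edges
    describe the velocity of the common vertex. *)
Lemma isoperimetric_of_reflection (Sigma : Z -> Prop) (J : R -> Prop) (y : Z -> R -> C) :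
  starts_regular Sigma J y ->
  (forall n t, Sigma n -> J t -> Cmod (vel J (y n) t) = 1) ->
  (forall n, edge Sigma n -> exists a, forall t, J t ->
     y n t <> y (n + 1)%Z t /\ edge_length y n t = a /\
     (vel J (y n) t * vel J (y (n + 1)%Z) t)%C = (tangent y n t * tangent y n t)%C) ->
  isoperimetric_motion Sigma J y.
Proof.
intros Hreg Hunit Hedge. split; [exact Hreg|]. split; [exact Hunit|]. split.
- intros n t Hn Jt. destruct (Hedge n Hn) as [a Ha]. split; [now apply Ha|].
  apply (der_ext J (fun _ => a)); [exact Jt| |now apply der_const].
  intros r Jr. symmetry. now apply Ha.
- assert (Hw : forall n t, exists w, edge Sigma n -> J t ->
    vel J (y n) t = (expi w * tangent y n t)%C :> C).
  { intros n t. destruct (classic (edge Sigma n /\ J t)) as [[He Jt]|Hn].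
    2:{ exists 0. intros He Jt. exfalso. now apply Hn. }
    destruct (Hedge n He) as [a Ha]. destruct (Ha t Jt) as [Hne _].
    assert (T := dot2_tangent y n t Hne).
    destruct (unit_angle (vel J (y n) t * Cconj (tangent y n t))%C) as [w Hw].
    { rewrite <- Cmod_sqr, Cmod_mult, Cmod_conj, Hunit by (trivial; apply He).
      rewrite Rmult_1_l. now rewrite Cmod_sqr. }
    exists w. intros _ _. rewrite <- Hw.
    transitivity (vel J (y n) t * RtoC (dot2 (tangent y n t) (tangent y n t)))%C.
    - rewrite T. symmetry. ring.
    - apply C_eq; coords; ring. }
  set (w := fun n t => proj1_sig (constructive_indefinite_description _ (Hw n t))).
  assert (W : forall n t, edge Sigma n -> J t ->
    vel J (y n) t = (expi (w n t) * tangent y n t)%C :> C).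
  { intros n t. exact (proj2_sig (constructive_indefinite_description _ (Hw n t))). }
  assert (V : forall n t, edge Sigma n -> J t ->
    vel J (y (n + 1)%Z) t = (expi (- w n t) * tangent y n t)%C :> C).
  { intros n t He Jt. destruct (Hedge n He) as [a Ha]. destruct (Ha t Jt) as [Hne [_ E]].
    rewrite W in E by assumption.
    transitivity (expi (- w n t) * expi (w n t) * vel J (y (n + 1)%Z) t)%C.
    - rewrite expi_opp. symmetry. ring.
    - assert (T : tangent y n t <> RtoC 0).
      { intros Z. assert (D := dot2_tangent y n t Hne). rewrite Z in D. coords. lra. }
      transitivity (expi (- w n t) * (expi (w n t) * tangent y n t *
        vel J (y (n + 1)%Z) t) / tangent y n t)%C; [field; exact T|].
      rewrite E. field. exact T. }
  (* solves the isoperimetric condition for the curvature *)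
  exists w, (fun n t => - w n t - w (n - 1)%Z t). intros n t He Jt.
  split; [now rewrite direction_expi, W|]. split.
  + intros Hs. replace (n + 1 - 1)%Z with n by lia. split; [|ring].
    assert (He' : edge Sigma (n + 1)%Z).
    { split; [apply He|]. now replace (n + 1 + 1)%Z with (n + 2)%Z by lia. }
    assert (E := V n t He Jt). rewrite (W _ t He' Jt) in E.
    unfold Rminus. rewrite expi_plus, <- Cmult_assoc, <- E, Cmult_assoc, expi_opp. symmetry. ring.
  + intros _. now rewrite direction_expi, V.
Qed.

(** * Tangential angles and the mKdV equation *)

(** The angle is the integral of [omega = det2 u u'].  The unit vectors [u] and
    [expi theta] turn with the same angular velocity, so their scalar product keeps
    its initial value [1]. *)
Lemma smooth_angle (J : R -> Prop) (u : R -> C) : interval J -> smooth_curve J u ->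
  (forall t, J t -> dot2 (u t) (u t) = 1) ->
  exists theta, smooth J theta /\ forall t, J t -> u t = expi (theta t).
Proof.
intros HJ Su Hu.
destruct (interval_inhabited J HJ) as [t0 J0].
destruct (unit_angle (u t0) (Hu t0 J0)) as [phi Hphi].
set (omega := fun t => det2 (u t) (vel J u t)).
assert (So : smooth J omega).
{ apply smooth_curve_iff in Su as Su'. destruct Su' as [U1 U2].
  destruct (proj1 (smooth_curve_iff _ _) (smooth_vel J u HJ Su)) as [V1 V2].
  intros k. apply class_plus; [|apply class_opp]; apply class_mult; auto. }
destruct (antiderivative_on J omega t0 HJ J0 (So 0%nat)) as [F [F0 HF]].
set (theta := fun t => phi + F t).
assert (Dth : forall t, J t -> der J theta t (omega t)).
{ intros t Jt. eapply der_eq; [exact (der_plus J _ _ t _ _ Jt (der_const J phi t Jt) (HF t Jt))|ring]. }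
exists theta. split; [now apply (smooth_of_der J theta omega)|].
assert (De : forall t, J t -> curve_der J (fun t => expi (theta t)) t
   (RtoC (omega t) * (Ci * expi (theta t)))%C).
{ intros t Jt. apply curve_der_iff; [exact Jt|]. split.
  - eapply der_eq; [exact (der_comp_out J cos theta t _ _ Jt (Dth t Jt) (is_derive_cos _))|].
    unfold expi, Re, Im, RtoC, Ci. simpl. ring.
  - eapply der_eq; [exact (der_comp_out J sin theta t _ _ Jt (Dth t Jt) (is_derive_sin _))|].
    unfold expi, Re, Im, RtoC, Ci. simpl. ring. }
assert (K : forall t, J t -> dot2 (u t) (expi (theta t)) = 1).
{ intros t Jt. transitivity (dot2 (u t0) (expi (theta t0))).
  - apply (constant_on J (fun t => dot2 (u t) (expi (theta t))) HJ); trivial.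
    intros r Jr. assert (Du := smooth_curve_der J u r HJ Su Jr).
    eapply der_eq; [exact (der_dot2 J _ _ r _ _ Jr Du (De r Jr))|].
    assert (O := der_unique J _ r _ _ HJ Jr (der_dot2 J _ _ r _ _ Jr Du Du)
      (der_ext J _ _ r 0 Jr (fun q Jq => eq_sym (Hu q Jq)) (der_const J 1 r Jr))).
    assert (O' : dot2 (u r) (vel J u r) = 0) by (unfold dot2 in *; lra).
    assert (Hur := Hu r Jr).
    assert (Un : u r <> RtoC 0) by (intros Z; rewrite Z in Hur; coords; lra).
    assert (Ev : vel J u r = (RtoC (omega r) * (Ci * u r))%C :> C).
    { apply (dot2_det2_inj (u r) _ _ Un).
      - rewrite O'. unfold dot2. simpl. unfold Re, Im. ring.
      - transitivity (omega r * dot2 (u r) (u r)); [rewrite Hur; unfold omega; ring|].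
        clearbody omega. coords. ring. }
    rewrite Ev. clearbody omega. coords. ring.
  - unfold theta. rewrite F0, Rplus_0_r, <- Hphi. now apply Hu. }
intros t Jt. specialize (K t Jt). specialize (Hu t Jt).
assert (E := dot2_expi (theta t)).
assert (Z : (Re (u t) - Re (expi (theta t))) ^ 2 + (Im (u t) - Im (expi (theta t))) ^ 2 = 0).
{ transitivity (dot2 (u t) (u t) - 2 * dot2 (u t) (expi (theta t)) +
    dot2 (expi (theta t)) (expi (theta t))); [unfold dot2; ring|]. rewrite K, Hu, E. ring. }
assert (Z1 := pow2_ge_0 (Re (u t) - Re (expi (theta t)))).
assert (Z2 := pow2_ge_0 (Im (u t) - Im (expi (theta t)))).
apply C_eq; apply Rminus_diag_uniq; apply Rsqr_0_uniq; unfold Rsqr; nra.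
Qed.

(** Two complex numbers with equal squares differ by a sign; by continuity the same
    sign holds on the whole interval. *)
Lemma half_angle_sign (J : R -> Prop) (a b : R -> R) (d : R -> C) (L : R) :
  interval J -> 0 < L -> (forall t, J t -> continuous_within J a t) -> (forall t, J t -> continuous_within J b t) ->
  (forall t, J t -> curve_continuous J d t) ->
  (forall t, J t -> (RtoC (L ^ 2) * (expi (a t) * expi (b t)))%C = (d t ^ 2)%C) ->
  (forall t, J t -> d t = (RtoC L * expi ((b t + a t) / 2))%C) \/
  (forall t, J t -> d t = (- (RtoC L * expi ((b t + a t) / 2)))%C).
Proof.
intros HJ HL Ha Hb Hd E.
set (e := fun t => (RtoC L * expi ((b t + a t) / 2))%C).
assert (Alt : forall t, J t -> d t = e t \/ d t = (- e t)%C).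
{ intros t Jt. specialize (E t Jt).
  replace (expi (a t) * expi (b t))%C with
    (expi ((b t + a t) / 2) * expi ((b t + a t) / 2))%C in E.
  2:{ rewrite <- !expi_plus. f_equal. field. }
  assert (Z : ((d t - e t) * (d t - - e t))%C = RtoC 0).
  { transitivity (d t ^ 2 - e t * e t)%C; [ring|]. rewrite <- E. unfold e.
    rewrite RtoC_pow. ring. }
  destruct (classic (d t = e t)) as [|N1]; [now left|right].
  apply NNPP. intros N2. revert Z. apply Cmult_neq_0; intros Z; [apply N1|apply N2];
    now apply Ceq_minus. }
assert (Ee : forall t, dot2 (e t) (e t) = L ^ 2).
{ intros t. transitivity (L ^ 2 * dot2 (expi ((b t + a t) / 2)) (expi ((b t + a t) / 2))).
  - unfold e. coords. ring.
  - rewrite dot2_expi. ring. }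
assert (Ce : forall t, J t -> curve_continuous J e t).
{ intros t Jt.
  assert (Lh : continuous_within J (fun t => (b t + a t) / 2) t).
  { apply continuous_within_mult; [|apply continuous_within_const]. apply continuous_within_plus; auto. }
  assert (Lc : continuous_within J (fun t => cos ((b t + a t) / 2)) t).
  { apply (continuous_within_comp (fun _ => True) J cos); auto. apply continuous_within_of_continuous, continuous_cos. }
  assert (Ls : continuous_within J (fun t => sin ((b t + a t) / 2)) t).
  { apply (continuous_within_comp (fun _ => True) J sin); auto. apply continuous_within_of_continuous, continuous_sin. }
  apply curve_continuous_mult; split; trivial; apply continuous_within_const. }
assert (L2 : 0 < L ^ 2) by now apply pow_lt.
assert (F1 : forall t, d t = e t -> dot2 (d t) (e t) = L ^ 2).
{ intros t ->. apply Ee. }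
assert (F2 : forall t, d t = (- e t)%C -> dot2 (d t) (e t) = - L ^ 2).
{ intros t ->. rewrite <- (Ee t). unfold dot2. simpl. unfold Re, Im. ring. }
assert (Lf : forall t, J t -> continuous_within J (fun t => dot2 (d t) (e t)) t).
{ intros t Jt. apply continuous_within_dot2; auto. }
assert (Nf : forall t, J t -> dot2 (d t) (e t) <> 0).
{ intros t Jt. destruct (Alt t Jt) as [H|H]; [rewrite (F1 t H)|rewrite (F2 t H)]; lra. }
destruct (classic (exists t, J t /\ 0 < dot2 (d t) (e t))) as [[t0 [J0 P]]|N].
- left. intros t Jt.
  assert (Pt := pos_of_nonzero_on J _ t0 HJ J0 Lf Nf P t Jt).
  destruct (Alt t Jt) as [H|H]; [exact H|]. assert (Q := F2 t H). cbv beta in Pt. lra.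
- right. intros t Jt. destruct (Alt t Jt) as [H|H]; [|exact H]. exfalso.
  apply N. exists t. split; [exact Jt|]. rewrite (F1 t H). exact L2.
Qed.

(** With [phi] the mean and [delta] half the difference of the two angles, the
    derivative [e^(i (phi + delta)) - e^(i (phi - delta))] of [d] is
    [2 i sin delta e^(i phi)], while [d = L e^(i phi)] gives [i L phi' e^(i phi)]. *)
Lemma mKdV_of_half_angle (J : R -> Prop) (a b : R -> R) (d : R -> C) (L t : R) :
  interval J -> 0 < L -> smooth J a -> smooth J b ->
  (forall r, J r -> d r = (RtoC L * expi ((b r + a r) / 2))%C) -> J t ->
  curve_der J d t (expi (b t) - expi (a t))%C ->
  der J (fun r => (b r + a r) / 2) t (2 / L * sin ((b t - a t) / 2)).
Proof.
intros HJ HL Sa Sb E Jt Dd.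
set (phi := fun r => (b r + a r) / 2). set (delta := (b t - a t) / 2).
assert (Dphi : exists w, der J phi t w).
{ exists ((deriv J b t + deriv J a t) * / 2 + (b t + a t) * 0).
  exact (der_mult J _ (fun _ => / 2) t _ _ Jt
    (der_plus J _ _ t _ _ Jt (smooth_der J b t HJ Sb Jt) (smooth_der J a t HJ Sa Jt))
    (der_const J (/ 2) t Jt)). }
destruct Dphi as [w Dphi]. apply (der_eq J phi t w); [exact Dphi|].
apply curve_der_iff in Dd as [D1 D2]; [|exact Jt].
assert (E1 : forall r, J r -> L * cos (phi r) = Re (d r)).
{ intros r Jr. rewrite E by exact Jr. unfold expi, Re, RtoC, phi. simpl. ring. }
assert (E2 : forall r, J r -> L * sin (phi r) = Im (d r)).
{ intros r Jr. rewrite E by exact Jr. unfold expi, Im, RtoC, phi. simpl. ring. }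
assert (K1 := der_unique J _ t _ _ HJ Jt D1 (der_ext J _ _ t _ Jt E1
  (der_scal J _ L t _ Jt (der_comp_out J cos phi t _ _ Jt Dphi (is_derive_cos _))))).
assert (K2 := der_unique J _ t _ _ HJ Jt D2 (der_ext J _ _ t _ Jt E2
  (der_scal J _ L t _ Jt (der_comp_out J sin phi t _ _ Jt Dphi (is_derive_sin _))))).
assert (Eb : b t = phi t + delta) by (unfold phi, delta; field).
assert (Ea : a t = phi t - delta) by (unfold phi, delta; field).
rewrite Ea, Eb in K1, K2. unfold expi, Re, Im in K1, K2. simpl in K1, K2.
rewrite cos_plus, cos_minus in K1. rewrite sin_plus, sin_minus in K2.
assert (C2 := sin2_cos2 (phi t)). unfold Rsqr in C2.
assert (Lw : L * w = 2 * sin delta).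
{ transitivity (L * w * (sin (phi t) * sin (phi t) + cos (phi t) * cos (phi t)));
    [rewrite C2; ring|].
  transitivity ((2 * sin delta) * (sin (phi t) * sin (phi t) + cos (phi t) * cos (phi t)));
    [|rewrite C2; ring].
  transitivity (- sin (phi t) * (L * (- sin (phi t) * w)) + cos (phi t) * (L * (cos (phi t) * w)));
    [ring|].
  rewrite <- K1, <- K2. ring. }
apply (Rmult_eq_reg_l L); [|lra]. rewrite Lw. field. lra.
Qed.

Lemma integer_primitive (e : Z -> Z) : exists j : Z -> Z, forall n, j (n + 1)%Z = (j n + e n)%Z.
Proof.
set (up := nat_rect (fun _ => Z) 0%Z (fun k z => (z + e (Z.of_nat k))%Z)).
set (down := nat_rect (fun _ => Z) 0%Z (fun k z => (z - e (- Z.of_nat k - 1))%Z)).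
exists (fun n => if (0 <=? n)%Z then up (Z.to_nat n) else down (Z.to_nat (- n))).
intros n. destruct (Z.leb_spec 0 n) as [H|H].
- destruct (Z.leb_spec 0 (n + 1)) as [_|H']; [|lia].
  replace (Z.to_nat (n + 1)) with (S (Z.to_nat n)) by lia. simpl.
  now rewrite Z2Nat.id by exact H.
- replace (Z.to_nat (- n)) with (S (Z.to_nat (- (n + 1)))) by lia. simpl.
  replace (- Z.of_nat (Z.to_nat (- (n + 1))) - 1)%Z with n by lia.
  destruct (Z.leb_spec 0 (n + 1)) as [H'|H'].
  + replace n with (-1)%Z by lia. simpl. lia.
  + lia.
Qed.

(** On each edge the sign of [half_angle_sign] decides whether the multiples of
    [2 PI] at its two ends must have equal or different parity.  As the edges form a
    path, these parities can be prescribed independently ([integer_primitive]). *)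
Lemma isoperimetric_mKdV (Sigma : Z -> Prop) (J : R -> Prop) (y : Z -> R -> C) :
  interval J -> (forall n, Sigma n -> smooth_curve J (y n)) ->
  isoperimetric_motion Sigma J y -> results_in_mKdV Sigma J y.
Proof.
intros HJ Sy Hiso. split.
- assert (H : forall n, exists theta, Sigma n -> smooth J theta /\
    forall s, J s -> vel J (y n) s = expi (theta s)).
  { intros n. destruct (classic (Sigma n)) as [Hn|Hn]; [|exists (fun _ => 0); tauto].
    destruct (smooth_angle J (vel J (y n)) HJ (smooth_vel J (y n) HJ (Sy n Hn)))
      as [theta Ht]; [|now exists theta].
    intros t Jt. rewrite <- Cmod_sqr. destruct Hiso as [_ [U _]]. rewrite U by assumption. ring. }
  exists (fun n => proj1_sig (constructive_indefinite_description _ (H n))).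
  intros n. exact (proj2_sig (constructive_indefinite_description _ (H n))).
- intros theta Hth.
  set (good := fun n => forall t, J t -> (y (n + 1)%Z t - y n t)%C =
    (RtoC (edge_length y n t) * expi ((theta (n + 1)%Z t + theta n t) / 2))%C).
  destruct (integer_primitive (fun n =>
    if excluded_middle_informative (good n) then 0%Z else 1%Z)) as [j Hj].
  exists j. intros n t He Jt.
  destruct (isoperimetric_edge_length Sigma J y n HJ Hiso He) as [L [HL EL]].
  destruct He as [Hn Hn1].
  destruct (Hth n Hn) as [Sa Va]. destruct (Hth _ Hn1) as [Sb Vb].
  assert (Alt : forall r, J r -> (y (n + 1)%Z r - y n r)%C =
    (RtoC L * expi (((theta (n + 1)%Z r + 2 * PI * IZR (j (n + 1)%Z)) +
                     (theta n r + 2 * PI * IZR (j n))) / 2))%C).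
  { specialize (Hj n). destruct (excluded_middle_informative (good n)) as [G|G].
    - intros r Jr. rewrite (G r Jr), EL by exact Jr. f_equal. rewrite Hj, plus_IZR.
      rewrite <- (expi_period _ (j n)). f_equal. field.
    - assert (Hs : forall r, J r ->
        (y (n + 1)%Z r - y n r)%C = (- (RtoC L * expi ((theta (n + 1)%Z r + theta n r) / 2)))%C).
      { destruct (half_angle_sign J (theta n) (theta (n + 1)%Z)
          (fun r => (y (n + 1)%Z r - y n r)%C) L HJ HL) as [Hs|Hs]; trivial.
        - exact (Sa 0%nat).
        - exact (Sb 0%nat).
        - intros r Jr. apply curve_continuous_minus; now apply curve_continuous_smooth; [apply Sy|].
        - intros r Jr. rewrite <- Va, <- Vb by exact Jr.
          rewrite (isoperimetric_edge Sigma J y n r Hiso) by (split || assumption; assumption).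
          rewrite <- (EL r Jr). apply tangent_sqr. destruct Hiso as [_ [_ [H _]]].
          now apply H.
        - exfalso. apply G. intros r Jr. rewrite (EL r Jr). now apply Hs. }
      intros r Jr. rewrite (Hs r Jr). rewrite Hj, plus_IZR.
      replace ((theta (n + 1)%Z r + 2 * PI * (IZR (j n) + 1) + (theta n r + 2 * PI * IZR (j n))) / 2)
        with ((theta (n + 1)%Z r + theta n r) / 2 + PI + 2 * PI * IZR (j n)) by field.
      rewrite expi_period, expi_plus.
      replace (expi PI) with (RtoC (-1)).
      + replace (RtoC (-1)) with (- RtoC 1)%C by (apply C_eq; coords; ring). ring.
      + apply C_eq; unfold expi, Re, Im, RtoC; simpl; [now rewrite cos_PI|now rewrite sin_PI]. }
  rewrite (EL t Jt).
  apply (mKdV_of_half_angle J (fun r => theta n r + 2 * PI * IZR (j n))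
    (fun r => theta (n + 1)%Z r + 2 * PI * IZR (j (n + 1)%Z)) (fun r => (y (n + 1)%Z r - y n r)%C) L t HJ HL); trivial.
  + intros k. apply class_plus; [apply Sa|apply class_const].
  + intros k. apply class_plus; [apply Sb|apply class_const].
  + rewrite !expi_period, <- Va, <- Vb by exact Jt.
    apply curve_der_minus; trivial; apply smooth_curve_der; auto.
Qed.

(** * The equivalences *)

(** By [trivial_of_negative], a negative parameter would make the edge trivially
    deformed at all times. *)
Lemma positive_parameter (Sigma : Z -> Prop) (I : R -> Prop) (x : Z -> R -> C)
    (m : R -> R) (mu : R) (n : Z) : interval I ->
  (forall n, Sigma n -> smooth_curve I (x n)) -> nontrivial Sigma I x ->
  edge Sigma n -> (forall s, I s -> m s <> 0) -> mu <> 0 ->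
  darboux_pair I m mu (x n) (x (n + 1)%Z) ->
  arc_length_polarization I m (x n) -> arc_length_polarization I m (x (n + 1)%Z) ->
  0 < mu /\ darboux_edge I m mu (x n) (x (n + 1)%Z).
Proof.
intros HI Sx Hnt He Hm Hmu Hd H1 H2.
assert (P : 0 < mu).
{ apply Rnot_le_lt. intros Hle. apply (Hnt n He).
  apply (trivial_of_negative I m mu); trivial; try (apply Sx, He). lra. }
split; [exact P|]. intros s Is.
destruct (proj1 (darboux_pair_iff _ _ _ _ _) Hd s Is) as [Hn E].
split; [exact Hn|]. split; [exact E|].
rewrite (darboux_edge_length I m mu _ _ Hm Hmu Hd H1 H2 s Is), Rabs_right by lra.
field. lra.
Qed.

Lemma isoperimetric_of_darboux (Sigma : Z -> Prop) (I : R -> Prop) (x : Z -> R -> C) :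
  interval I -> (forall n, Sigma n -> smooth_curve I (x n)) ->
  starts_regular Sigma I x -> nontrivial Sigma I x -> arc_length_darboux Sigma I x ->
  exists (J : R -> Prop) (sigma : R -> R), reparametrization J I sigma /\
    isoperimetric_motion Sigma J (fun n t => x n (sigma t)).
Proof.
intros HI Sx [s0 [I0 Hreg]] Hnt [m [mu [Hm [Hed Hpol]]]].
assert (Hrep : exists J sigma, reparametrization J I sigma /\
  forall n t, Sigma n -> J t -> deriv J sigma t ^ 2 * / m (sigma t) = 1).
{ destruct (classic (exists n, Sigma n)) as [[n0 H0]|Hno].
  - destruct (arc_length_reparametrization I (x n0) HI (Sx n0 H0)) as [J [sigma [Hr Hu]]].
    { intros s Is Z. destruct (polarization_sqr I m _ s Is (Hpol n0 H0) (Hm s Is)) as [M E].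
      rewrite Z in E. apply Rinv_0_lt_compat in M. coords. lra. }
    exists J, sigma. split; [exact Hr|]. intros n t _ Jt.
    assert (Is : I (sigma t)) by now apply Hr.
    destruct (polarization_sqr I m _ _ Is (Hpol n0 H0) (Hm _ Is)) as [_ E].
    rewrite <- E, <- Cmod_sqr, <- (pow2_abs (deriv J sigma t)), <- Rpow_mult_distr.
    rewrite <- Cmod_R, <- Cmod_mult, Hu by exact Jt. ring.
  - exists I, (fun s => s). split; [now apply trivial_reparametrization|].
    intros n t Hn. exfalso. apply Hno. now exists n. }
destruct Hrep as [J [sigma [Hr Hspeed]]]. exists J, sigma. split; [exact Hr|].
assert (Hr' := Hr). destruct Hr' as [HJ [_ [HJI [Hsur Hnz]]]].
apply isoperimetric_of_reflection.
- destruct (Hsur s0 I0) as [t0 [J0 <-]]. now exists t0.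
- intros n t Hn Jt.
  rewrite (vel_reparametrized J I sigma (x n) t HI Hr (Sx n Hn) Jt).
  assert (Is := HJI t Jt).
  destruct (polarization_sqr I m _ _ Is (Hpol n Hn) (Hm _ Is)) as [_ E].
  assert (E2 : Cmod (RtoC (deriv J sigma t) * vel I (x n) (sigma t))%C ^ 2 = 1).
  { rewrite Cmod_mult, Cmod_R, Rpow_mult_distr, pow2_abs, Cmod_sqr, E. now apply (Hspeed n). }
  assert (P := Cmod_ge_0 (RtoC (deriv J sigma t) * vel I (x n) (sigma t))%C). nra.
- intros n He. destruct (Hed n He) as [Hmu Hd]. assert (He' := He). destruct He' as [Hn Hn1].
  destruct (positive_parameter Sigma I x m (mu n) n) as [P HD]; auto.
  (* the edge length prescribed by the discrete polarization *)
  exists (sqrt (/ mu n)). intros t Jt. assert (Is := HJI t Jt).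
  destruct (HD _ Is) as [Hne [E N]].
  assert (Hxx : x n (sigma t) <> x (n + 1)%Z (sigma t)).
  { intros Z. apply Hne. rewrite Z. ring. }
  assert (L : edge_length x n (sigma t) ^ 2 = / mu n).
  { rewrite edge_length_sqr. apply (Rmult_eq_reg_l (mu n)); [|lra]. rewrite N. field. lra. }
  split; [exact Hxx|]. split.
  + change (edge_length x n (sigma t) = sqrt (/ mu n)). rewrite <- L, sqrt_pow2; [reflexivity|].
    apply Cmod_ge_0.
  + rewrite (vel_reparametrized J I sigma (x n) t HI Hr (Sx n Hn) Jt).
    rewrite (vel_reparametrized J I sigma (x (n + 1)%Z) t HI Hr (Sx _ Hn1) Jt).
    change (tangent (fun n t => x n (sigma t)) n t) with (tangent x n (sigma t)).
    transitivity (RtoC (deriv J sigma t ^ 2) *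
      (vel I (x n) (sigma t) * vel I (x (n + 1)%Z) (sigma t)))%C.
    { rewrite RtoC_pow. ring. }
    rewrite E, <- (tangent_sqr x n (sigma t) Hxx), L.
    transitivity (RtoC (deriv J sigma t ^ 2 * / m (sigma t) * (mu n * / mu n)) *
      (tangent x n (sigma t) * tangent x n (sigma t)))%C.
    { unfold Rdiv. rewrite !RtoC_mult. ring. }
    rewrite (Hspeed n t Hn Jt), Rinv_r by lra. rewrite Rmult_1_r. ring.
Qed.

Lemma darboux_of_isoperimetric (Sigma : Z -> Prop) (I J : R -> Prop) (sigma : R -> R)
    (x : Z -> R -> C) :
  interval I -> (forall n, Sigma n -> smooth_curve I (x n)) ->
  reparametrization J I sigma -> isoperimetric_motion Sigma J (fun n t => x n (sigma t)) ->
  starts_regular Sigma I x /\ nontrivial Sigma I x /\ arc_length_darboux Sigma I x.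
Proof.
intros HI Sx Hr Hiso. assert (Hr' := Hr). destruct Hr' as [HJ [_ [HJI [Hsur Hnz]]]].
assert (Hiso' := Hiso). destruct Hiso' as [[t0 [J0 Hreg]] [Hunit [Hne _]]].
assert (Hprod : forall n t, edge Sigma n -> J t ->
  (RtoC (deriv J sigma t ^ 2) * (vel I (x n) (sigma t) * vel I (x (n + 1)%Z) (sigma t)))%C
   = (tangent x n (sigma t) * tangent x n (sigma t))%C).
{ intros n t He Jt. assert (E := isoperimetric_edge Sigma J _ n t Hiso He Jt).
  change (tangent (fun n t => x n (sigma t)) n t) with (tangent x n (sigma t)) in E.
  rewrite <- E, !(vel_reparametrized J I sigma _ t HI Hr) by (trivial; apply Sx, He).
  rewrite RtoC_pow. ring. }
assert (Hspeed : forall n t, Sigma n -> J t ->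
  deriv J sigma t ^ 2 * dot2 (vel I (x n) (sigma t)) (vel I (x n) (sigma t)) = 1).
{ intros n t Hn Jt. assert (U := Hunit n t Hn Jt).
  rewrite (vel_reparametrized J I sigma _ t HI Hr (Sx n Hn) Jt), Cmod_mult, Cmod_R in U.
  rewrite <- Cmod_sqr, <- pow2_abs, <- Rpow_mult_distr, U. ring. }
split; [|split].
- exists (sigma t0). split; [auto|exact Hreg].
- intros n He H. destruct (H (sigma t0) (HJI t0 J0)) as [Ev Hdet].
  assert (E := Hprod n t0 He J0). rewrite Ev in E.
  destruct (Hne n t0 He J0) as [Hxx _].
  assert (P := edge_length_pos x n (sigma t0) Hxx).
  set (u := vel I (x n) (sigma t0)) in *. set (T := tangent x n (sigma t0)) in *.
  assert (Z : ((RtoC (deriv J sigma t0) * u - T) * (RtoC (deriv J sigma t0) * u + T))%C = RtoC 0).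
  { rewrite RtoC_pow in E. transitivity (RtoC (deriv J sigma t0) ^ 2 * (u * u) - T * T)%C; [ring|].
    rewrite E. ring. }
  assert (Det : det2 u T = 0).
  { apply (Rmult_eq_reg_l (deriv J sigma t0)); [|auto].
    assert (Par : (RtoC (deriv J sigma t0) * u)%C = T \/ (RtoC (deriv J sigma t0) * u)%C = (- T)%C).
    { destruct (classic ((RtoC (deriv J sigma t0) * u)%C = T)) as [|N1]; [now left|right].
      apply NNPP. intros N2. revert Z. apply Cmult_neq_0; intros Z; [apply N1|apply N2].
      - now apply Ceq_minus.
      - transitivity ((RtoC (deriv J sigma t0) * u + T) - T)%C; [ring|]. rewrite Z. ring. }
    transitivity (det2 (RtoC (deriv J sigma t0) * u)%C T); [coords; ring|].
    destruct Par as [-> | ->]; coords; ring. }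
  apply Hdet.
  replace (x (n + 1)%Z (sigma t0) - x n (sigma t0))%C with (RtoC (edge_length x n (sigma t0)) * T)%C.
  + transitivity (edge_length x n (sigma t0) * det2 u T); [coords; ring|]. rewrite Det. ring.
  + unfold T, tangent. field. intros K. apply RtoC_inj in K. lra.
- (* [m s] is the square of [sigma'] over [s], characterized by the common speed
     of the vertices; without vertices any nonzero value qualifies *)
  set (m := fun s => epsilon (inhabits 1) (fun v => v <> 0 /\ forall n, Sigma n ->
    dot2 (vel I (x n) s) (vel I (x n) s) = / v)).
  assert (M : forall s, I s -> m s <> 0 /\ forall n, Sigma n ->
    dot2 (vel I (x n) s) (vel I (x n) s) = / m s).
  { intros s Is. apply (epsilon_spec (inhabits 1) (fun v => v <> 0 /\ forall n, Sigma n ->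
      dot2 (vel I (x n) s) (vel I (x n) s) = / v)).
    destruct (Hsur s Is) as [t [Jt <-]]. exists (deriv J sigma t ^ 2).
    assert (P : deriv J sigma t ^ 2 <> 0) by (apply pow_nonzero; auto).
    split; [exact P|]. intros n Hn. apply (Rmult_eq_reg_l (deriv J sigma t ^ 2)); [|exact P].
    rewrite (Hspeed n t Hn Jt). symmetry. now apply Rinv_r. }
  exists m, (fun n => / edge_length x n (sigma t0) ^ 2). split; [apply M|]. split.
  + intros n He.
    destruct (isoperimetric_edge_length Sigma J _ n HJ Hiso He) as [a [Ha EL]].
    assert (E0 : edge_length x n (sigma t0) = a) by exact (EL t0 J0). rewrite E0.
    assert (P : a ^ 2 <> 0) by (apply pow_nonzero; lra).
    split; [now apply Rinv_neq_0_compat|].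
    apply darboux_pair_iff. intros s Is. destruct (M s Is) as [Hm Em].
    destruct (Hsur s Is) as [t [Jt <-]]. destruct (Hne n t He Jt) as [Hxx _].
    assert (Ea : edge_length x n (sigma t) = a) by exact (EL t Jt).
    split; [intros Z; apply Hxx; symmetry; now apply Ceq_minus|].
    assert (E := Hprod n t He Jt). assert (S := Hspeed n t (proj1 He) Jt).
    rewrite (Em n (proj1 He)) in S.
    rewrite <- (tangent_sqr x n (sigma t) Hxx), Ea, <- E.
    transitivity (RtoC ((deriv J sigma t ^ 2 * / m (sigma t)) * (/ a ^ 2 * a ^ 2)) *
       (vel I (x n) (sigma t) * vel I (x (n + 1)%Z) (sigma t)))%C.
    * rewrite S, Rinv_l by exact P. rewrite Rmult_1_l. ring.
    * unfold Rdiv. rewrite !RtoC_mult. ring.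
  + intros n Hn s Is. destruct (M s Is) as [_ Em]. rewrite Cmod_sqr, (Em n Hn).
    unfold Rdiv. ring.
Qed.

Lemma infinitesimal_of_darboux (Sigma : Z -> Prop) (I : R -> Prop) (x : Z -> R -> C) :
  interval I -> (forall n, Sigma n -> smooth_curve I (x n)) ->
  nontrivial Sigma I x -> arc_length_darboux Sigma I x ->
  arc_length_infinitesimal_darboux Sigma I x.
Proof.
intros HI Sx Hnt [m [mu [Hm [Hed Hpol]]]].
destruct (interval_inhabited I HI) as [s0 I0].
assert (Hp : forall n, edge Sigma n -> 0 < mu n /\ darboux_edge I m (mu n) (x n) (x (n + 1)%Z)).
{ intros n He. destruct (Hed n He) as [Hmu Hd].
  apply (positive_parameter Sigma); auto; apply Hpol, He. }
assert (Hlen : forall s, I s -> discrete_arc_length_polarization Sigma mu (fun n => x n s)).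
{ intros s Is n He. destruct (Hp n He) as [P HD]. destruct (HD s Is) as [_ [_ N]].
  rewrite Cmod_sqr. apply (Rmult_eq_reg_l (mu n)); [|lra].
  transitivity 1; [field; lra|]. rewrite <- N. unfold dot2. simpl. unfold Re, Im. ring. }
exists (fun n => x n s0), mu, m. split; [left; intros n He; now apply Hp|].
split; [exact Hm|]. split; [|split; [now apply Hlen|exact Hlen]].
split; [exists s0; now split|]. intros n He. now apply Hed.
Qed.

Lemma darboux_of_infinitesimal (Sigma : Z -> Prop) (I : R -> Prop) (x : Z -> R -> C) :
  discrete_interval Sigma -> interval I -> (forall n, Sigma n -> smooth_curve I (x n)) ->
  three_vertices Sigma -> starts_regular Sigma I x ->
  arc_length_infinitesimal_darboux Sigma I x ->
  nontrivial Sigma I x /\ arc_length_darboux Sigma I x.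
Proof.
intros HS HI Sx [k [K1 [K2 K3]]] [s0 [I0 Hreg]] [x0 [mu [m [_ [Hm [[_ Hd] [_ Hlen]]]]]]].
assert (Hed : forall n, edge Sigma n -> darboux_edge I m (mu n) (x n) (x (n + 1)%Z)).
{ intros n He s Is.
  destruct (proj1 (darboux_pair_iff _ _ _ _ _) (Hd n He) s Is) as [Hn E].
  split; [exact Hn|]. split; [exact E|].
  assert (L := Hlen s Is n He). cbv beta in L. rewrite Cmod_sqr in L.
  assert (P := dot2_pos _ Hn).
  replace (dot2 (x n s - x (n + 1)%Z s)%C (x n s - x (n + 1)%Z s)%C)
    with (dot2 (x (n + 1)%Z s - x n s)%C (x (n + 1)%Z s - x n s)%C) in L
    by (unfold dot2; simpl; unfold Re, Im; ring).
  rewrite <- L in *.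
  destruct (Req_dec (mu n) 0) as [Z|Z]; [|field; exact Z].
  exfalso. rewrite Z in P. unfold Rdiv in P. rewrite Rinv_0, Rmult_0_r in P. lra. }
assert (Htriple : forall n, Sigma (n - 1)%Z -> Sigma n -> Sigma (n + 1)%Z -> forall s, I s ->
  dot2 (vel I (x (n - 1)%Z) s) (vel I (x (n - 1)%Z) s) = / m s /\
  dot2 (vel I (x n) s) (vel I (x n) s) = / m s /\
  dot2 (vel I (x (n + 1)%Z) s) (vel I (x (n + 1)%Z) s) = / m s).
{ intros n H1 H2 H3.
  apply (arc_length_of_triple I m (mu (n - 1)%Z) (mu n) _ _ _ s0); auto.
  - replace (x n) with (x (n - 1 + 1)%Z) by (f_equal; lia). apply Hed. split; [exact H1|].
    now replace (n - 1 + 1)%Z with n by lia.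
  - apply Hed. now split. }
assert (Hspeed : forall n s, Sigma n -> I s -> dot2 (vel I (x n) s) (vel I (x n) s) = / m s).
{ intros n s Hn Is. destruct (Z_lt_le_dec n k) as [Hlt|Hle].
  - assert (H1 : Sigma (n + 1)%Z) by (apply (HS n _ k); trivial; lia).
    assert (H2 : Sigma (n + 1 + 1)%Z) by (apply (HS n _ (k + 1)%Z); trivial; lia).
    destruct (Htriple (n + 1)%Z) with (s := s) as [E _]; trivial.
    + now replace (n + 1 - 1)%Z with n by lia.
    + now replace (n + 1 - 1)%Z with n in E by lia.
  - destruct (Z.eq_dec n k) as [-> |Hne]; [apply (Htriple k K1 K2 K3 s Is)|].
    assert (H1 : Sigma (n - 1)%Z) by (apply (HS k _ n); trivial; lia).
    assert (H2 : Sigma (n - 1 - 1)%Z) by (apply (HS (k - 1)%Z _ n); trivial; lia).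
    destruct (Htriple (n - 1)%Z) with (s := s) as [_ [_ E]]; trivial.
    + now replace (n - 1 + 1)%Z with n by lia.
    + now replace (n - 1 + 1)%Z with n in E by lia. }
assert (Hmu : forall n, edge Sigma n -> 0 < mu n).
{ intros n He. destruct (Hed n He s0 I0) as [Hn [_ N]]. apply dot2_pos in Hn.
  apply Rnot_le_lt. intros Hle. nra. }
assert (Hpol : forall n, Sigma n -> arc_length_polarization I m (x n)).
{ intros n Hn s Is. rewrite Cmod_sqr, (Hspeed n s Hn Is). unfold Rdiv. ring. }
split.
- intros n He H. destruct (H s0 I0) as [Ev Hdet].
  destruct (Hed n He s0 I0) as [Hn [E N]].
  destruct (polarization_sqr I m _ s0 I0 (Hpol n (proj1 He)) (Hm s0 I0)) as [M _].
  apply product_in_edge_frame in E as [E1 [E2 _]]. rewrite Ev in E1, E2.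
  apply dot2_pos in Hn. specialize (Hmu n He).
  set (d := (x (n + 1)%Z s0 - x n s0)%C) in *. set (u := vel I (x n) s0) in *.
  assert (Hb : det2 d u <> 0) by (intros Z; apply Hdet; unfold det2 in *; lra).
  assert (Ha : dot2 d u = 0) by (apply (Rmult_eq_reg_r (det2 d u)); lra).
  rewrite Ha in E1. assert (0 < mu n / m s0) by now apply Rdiv_lt_0_compat.
  assert (0 < dot2 d d ^ 2) by now apply pow_lt. nra.
- exists m, mu. split; [exact Hm|]. split; [|exact Hpol].
  intros n He. split; [|now apply Hd]. specialize (Hmu n He). lra.
Qed.

Theorem theorem3p4 (Sigma : Z -> Prop) (I : R -> Prop) (x : Z -> R -> C)
    (HSigma : discrete_interval Sigma) (HI : interval I)
    (Hx : forall n : Z, Sigma n -> smooth_curve I (x n)) :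
  (* (i) <-> (iii) *)
  ((starts_regular Sigma I x /\ nontrivial Sigma I x /\
    arc_length_darboux Sigma I x) <->
   (exists (J : R -> Prop) (sigma : R -> R),
      reparametrization J I sigma /\
      isoperimetric_motion Sigma J (fun n t => x n (sigma t)))) /\
  (* (i) -> (ii) *)
  (nontrivial Sigma I x -> arc_length_darboux Sigma I x ->
   arc_length_infinitesimal_darboux Sigma I x) /\
  (* (ii) -> (i) *)
  (three_vertices Sigma -> starts_regular Sigma I x ->
   arc_length_infinitesimal_darboux Sigma I x ->
   nontrivial Sigma I x /\ arc_length_darboux Sigma I x) /\
  (* (iii) results in the semi-discrete potential mKdV equation *)
  (forall (J : R -> Prop) (sigma : R -> R),
     reparametrization J I sigma ->
     isoperimetric_motion Sigma J (fun n t => x n (sigma t)) ->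
     results_in_mKdV Sigma J (fun n t => x n (sigma t))).
Proof.
split; [split|split; [|split]].
- intros [H1 [H2 H3]]. now apply isoperimetric_of_darboux.
- intros [J [sigma [Hr H]]]. now apply (darboux_of_isoperimetric Sigma I J sigma).
- now apply infinitesimal_of_darboux.
- now apply darboux_of_infinitesimal.
- intros J sigma Hr H. apply isoperimetric_mKdV; trivial.
  + apply Hr.
  + intros n Hn. apply (smooth_reparametrized J I sigma (x n) Hr). now apply Hx.
Qed.
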